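(* Let $(\mathcal{M},\mathcal{D})$ be a $W^*$-inclusion. If $(\mathcal{M},\mathcal{D})$ has the unique pseudo-expectation property, then $\mathcal{D}^c = Z(\mathcal{D})$.
   Context: A $C^*$-inclusion $(\mathcal{C},\mathcal{D})$ is a pair of unital $C^*$-algebras with $\mathcal{D} \subseteq \mathcal{C}$ and having the same unit. A $W^*$-inclusion $(\mathcal{M},\mathcal{D})$ is a $C^*$-inclusion such that $\mathcal{M}$ is a $W^*$-algebra and $\mathcal{D}$ is $\sigma(\mathcal{M},\mathcal{M}_* )$-closed. $\mathcal{D}^c=\mathcal{D}'\cap\mathcal{M}$ is the relative commutant of $\mathcal{D}$ in $\mathcal{M}$, and $Z(\mathcal{D})$ is the center of $\mathcal{D}$. ''ucp'' means unital completely positive. A $C^*$-algebra is injective if it is an injective object in the category of operator systems and ucp maps. $I(\mathcal{D})$ denotes a fixed injective envelope of $\mathcal{D}$: an injective unital $C^*$-algebra containing $\mathcal{D}$ as a unital $C^*$-subalgebra, such that for every injective operator system $\mathcal{S}$ and unital complete isometry $\tau:\mathcal{D}\to\mathcal{S}$ there is a unital complete isometry $\tau_1:I(\mathcal{D})\to\mathcal{S}$ with $\tau_1|_{\mathcal{D}}=\tau$. A pseudo-expectation for $(\mathcal{M},\mathcal{D})$ is a ucp map $\Phi:\mathcal{M}\to I(\mathcal{D})$ with $\Phi|_{\mathcal{D}}=\operatorname{id}$; the inclusion has the unique pseudo-expectation property if exactly one pseudo-expectation exists. *)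

(* Defs.v *)
From HB Require Import structures.
From mathcomp Require Import all_boot all_order all_algebra.
From mathcomp Require Import all_classical all_reals all_analysis.
From mathcomp Require Import complex.
Set Implicit Arguments.
Unset Strict Implicit.
Unset Printing Implicit Defensive.
Import Order.TTheory GRing.Theory Num.Theory.
Import numFieldNormedType.Exports.
Local Open Scope classical_set_scope.
Local Open Scope complex_scope.
Local Open Scope ring_scope.

(* The multiplication is part of the mixin because Hierarchy Builder rejects a
   structure inheriting from both the library's rings and its normed modules,
   of which numDomainType is the declared join. *)
HB.mixin Record isCStar (R : realType) A of CompleteNormedModule R[i] A := {
  cstar_one : A;
  cstar_mul : A -> A -> A;
  star : A -> A;
  cstar_mulA : associative cstar_mul;
  cstar_mul1x : left_id cstar_one cstar_mul;
  cstar_mulx1 : right_id cstar_one cstar_mul;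
  cstar_mulDl : left_distributive cstar_mul +%R;
  cstar_mulDr : right_distributive cstar_mul +%R;
  cstar_scaleAl : forall (a : R[i]) (x y : A),
    a *: cstar_mul x y = cstar_mul (a *: x) y;
  cstar_scaleAr : forall (a : R[i]) (x y : A),
    a *: cstar_mul x y = cstar_mul x (a *: y);
  cstar_normM_le : forall x y : A, `|cstar_mul x y| <= `|x| * `|y|;
  starK : forall x : A, star (star x) = x;
  starD : forall x y : A, star (x + y) = star x + star y;
  starZ : forall (a : R[i]) (x : A), star (a *: x) = a^* *: star x;
  cstar_starM : forall x y : A,
    star (cstar_mul x y) = cstar_mul (star y) (star x);
  cstar_norm_starM : forall x : A, `|cstar_mul (star x) x| = `|x| ^+ 2
}.

#[short(type="cstarType")]
HB.structure Definition CStar (R : realType) :=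
  {A of isCStar R A & CompleteNormedModule R[i] A}.

HB.instance Definition _ (R : realType) (A : cstarType R) :=
  GRing.Zmodule_isPzRing.Build (CStar.sort A) (@cstar_mulA R A)
    (@cstar_mul1x R A) (@cstar_mulx1 R A) (@cstar_mulDl R A)
    (@cstar_mulDr R A).

(* Library norms over R[i] take values in R[i]; they are real and nonnegative. *)
Definition rnorm (R : realType) (V : normedModType R[i]) (x : V) : R :=
  complex.Re `|x|.

Section CStarAlgebras.
Context {R : realType}.
Implicit Types A B : cstarType R.

Definition cstar_subalgebra A (D : set A) : Prop :=
  [/\ D 1,
      forall (a : R[i]) x y, D x -> D y -> D (a *: x + y),
      forall x y, D x -> D y -> D (x * y),
      forall x, D x -> D (star x)
    & closed D].

Definition relative_commutant A (D : set A) : set A :=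
  [set x | forall d, D d -> x * d = d * x].

Definition cstar_center A (D : set A) : set A :=
  [set z | D z /\ forall d, D d -> z * d = d * z].

(* W*-algebras (Sakai): [pairing] identifies A isometrically with the Banach
   dual of X, so X is the predual of A. *)
Definition is_predual A (X : completeNormedModType R[i])
    (pairing : A -> X -> R[i]^o) : Prop :=
  [/\ forall (a : R[i]) m m' x,
        pairing (a *: m + m') x = a * pairing m x + pairing m' x,
      forall m, linear (pairing m) /\ continuous (pairing m),
      forall m, rnorm m =
        sup [set rnorm (pairing m x) | x in [set x : X | rnorm x <= 1]]
    & forall f : X -> R[i]^o, linear f -> continuous f ->
        exists m, pairing m = f].

(* sigma(A, X): the topology induced on A by pointwise convergence on X. *)
Definition sigma_closed A (X : completeNormedModType R[i])
    (pairing : A -> X -> R[i]^o) (D : set A) : Prop :=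
  closed (D : set (@initial_topology A {ptws X -> R[i]^o} pairing)).

Definition wstar_inclusion A (X : completeNormedModType R[i])
    (pairing : A -> X -> R[i]^o) (D : set A) : Prop :=
  [/\ is_predual pairing, cstar_subalgebra D & sigma_closed pairing D].

Definition mxadj A m n (Y : 'M[A]_(m, n)) : 'M[A]_(n, m) :=
  map_mx star Y^T.

Definition mxpositive A n (Y : 'M[A]_n) : Prop :=
  exists Z : 'M[A]_n, Y = mxadj Z *m Z.

(* The norm of the Hilbert A-module A^n, whose A-valued inner product is
   <u, v> = sum_i u_i^* v_i. *)
Definition colnorm A n (v : 'cV[A]_n) : R :=
  Num.sqrt (rnorm ((mxadj v *m v) 0 0)).

(* The C*-norm of M_n(A), as the algebra of adjointable operators on A^n. *)
Definition mxnorm A n (Y : 'M[A]_n) : R :=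
  sup [set colnorm (Y *m v) | v in [set v : 'cV[A]_n | colnorm v <= 1]].

Definition mxover A n (S : set A) : set 'M[A]_n :=
  [set Y | forall i j, S (Y i j)].

(* Operator systems are concrete: unital self-adjoint subspaces of a unital
   C*-algebra, with the matrix order and matrix norms of that algebra. *)
Definition operator_system A (S : set A) : Prop :=
  [/\ S 1,
      forall (a : R[i]) x y, S x -> S y -> S (a *: x + y)
    & forall x, S x -> S (star x)].

(* A morphism from S to T is a function between the ambient C*-algebras, of
   which only the values on S are relevant. *)
Definition unital_linear_on A B (S : set A) (T : set B) (f : A -> B) : Prop :=
  [/\ forall x, S x -> T (f x),
      f 1 = 1
    & forall (a : R[i]) x y, S x -> S y -> f (a *: x + y) = a *: f x + f y].

Definition ucp A B (S : set A) (T : set B) (f : A -> B) : Prop :=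
  unital_linear_on S T f /\
  forall n (Y : 'M[A]_n), mxover S Y -> mxpositive Y -> mxpositive (map_mx f Y).

Definition unital_complete_isometry A B (S : set A) (T : set B) (f : A -> B) :
    Prop :=
  unital_linear_on S T f /\
  forall n (Y : 'M[A]_n), mxover S Y -> mxnorm (map_mx f Y) = mxnorm Y.

(* Injective object for operator systems and ucp maps, the embeddings being
   written as inclusions E `<=` F in a common ambient C*-algebra. *)
Definition injective_system B (T : set B) : Prop :=
  operator_system T /\
  forall A (E F : set A), operator_system E -> operator_system F -> E `<=` F ->
  forall f : A -> B, ucp E T f ->
  exists g : A -> B, ucp F T g /\ (forall x, E x -> g x = f x).

(* [iota], restricted to D, is the embedding of D as a unital C*-subalgebra. *)
Definition unital_star_embedding A B (D : set A) (iota : A -> B) : Prop :=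
  [/\ unital_linear_on D setT iota,
      forall x y, D x -> D y -> iota (x * y) = iota x * iota y,
      forall x, D x -> iota (star x) = star (iota x)
    & forall x y, D x -> D y -> iota x = iota y -> x = y].

Definition injective_envelope A (D : set A) (I : cstarType R) (iota : A -> I) :
    Prop :=
  [/\ injective_system [set: I],
      unital_star_embedding D iota
    & forall B (S : set B), injective_system S ->
      forall tau : A -> B, unital_complete_isometry D S tau ->
      exists tau1 : I -> B, unital_complete_isometry [set: I] S tau1 /\
        (forall d, D d -> tau1 (iota d) = tau d)].

Definition pseudo_expectation A (D : set A) (I : cstarType R) (iota : A -> I)
    (Phi : A -> I) : Prop :=
  ucp [set: A] [set: I] Phi /\ (forall d, D d -> Phi d = iota d).

Definition unique_pseudo_expectation A (D : set A) (I : cstarType R)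
    (iota : A -> I) : Prop :=
  exists! Phi : A -> I, pseudo_expectation D iota Phi.

End CStarAlgebras.

(* Main.v *)
Require Import Defs.
From mathcomp Require Import all_boot all_order all_algebra.
From mathcomp Require Import all_classical all_reals all_analysis.
From mathcomp Require Import complex ring lra.
From Stdlib Require Ncring Ncring_tac.
(** Write D^c for the relative commutant of D in M and Phi for the unique
    pseudo-expectation.  Only the inclusion of D^c in D needs a proof.

    Uniqueness is used through one construction.  Let e >= 0 commute with D and
    be faithful on D (d e = 0 forces d = 0 for d in D), and let k be self-adjoint
    with k e = 0.  On the operator system D + C k, forgetting the k-component
    is completely positive: if d + k b >= 0 is a matrix over it, compressing by
    the square root of e gives d e >= 0, and faithfulness of e turns this into
    d >= 0 ([positive_of_faithful_compression]).  By injectivity it extends to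
    a pseudo-expectation that kills k, so Phi k = 0
    ([pseudo_expectation_killing]).

    Faithful elements e come from the weak-star closedness of D: for f >= 0
    commuting with D, the ideal of all d in D with d f = 0 has the form D p for
    a projection p central in D ([annihilator_projection]), and f + p is faithful.
    For y self-adjoint in D^c take f to be the positive part of y.  Then p
    annihilates the positive part, while k = (negative part of y)(1 - p) is
    annihilated by f + p, so Phi k = 0 ([separating_projection]).

    Applied to y = h - eps with h >= 0 in D^c and Phi h = 0, this shows that
    h <= eps: Phi is faithful on D^c ([pseudo_expectation_faithful]).  Hence the
    k above is 0, that is, p separates the two parts of y exactly.  So a
    self-adjoint x in D^c with norm at most r is within r / 2 of
    (r / 2)(1 - 2 p), an element of D ([halving]); iterating, x is a norm limit
    of elements of D, and D is norm closed.

    The rest of the file derives the needed spectral theory from the axioms of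
    a C*-algebra: square roots by a convergent iteration, positivity of z^* z,
    positive and negative parts, fourth roots in matrix algebras, and
    ultrafilter limits for the weak-star topology. *)
Set Implicit Arguments.
Unset Strict Implicit.
Unset Printing Implicit Defensive.
Import Order.TTheory GRing.Theory Num.Theory.
Import numFieldNormedType.Exports.
Local Open Scope complex_scope.
Local Open Scope classical_set_scope.
Local Open Scope ring_scope.

(** * Identities in noncommutative rings *)
Module NoncommutativeRing.
Import -(notations) Ncring Ncring_tac.

#[export] Instance pzRing_ops (B : pzRingType) :
  @Ring_ops B 0 1 +%R *%R (fun x y => x - y) -%R (@eq B) := {}.

#[export] Instance pzRing_ring (B : pzRingType) : Ring (Ro := pzRing_ops B).
Proof.
constructor.
- exact: eq_equivalence.
- by move=> x y e x' y' e'; rewrite e e'.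
- by move=> x y e x' y' e'; rewrite e e'.
- by move=> x y e x' y' e'; rewrite e e'.
- by move=> x y /= ->.
- exact: add0r.
- exact: addrC.
- exact: addrA.
- exact: mul1r.
- exact: mulr1.
- exact: mulrA.
- move=> *; exact: mulrDl.
- move=> *; exact: mulrDr.
- by [].
- exact: subrr.
Qed.

Ltac ncring := non_commutative_ring.
End NoncommutativeRing.
Import NoncommutativeRing.

(** * Real-valued norms and real scalars *)
Section RealNorm.
Context {R : realType}.
Implicit Type V : normedModType R[i].

Lemma norm_rnorm V (x : V) : `|x| = (rnorm x)%:C.
Proof.
have : 0 <= `|x| by [].
rewrite /rnorm; case: (`|x|) => a b; rewrite lecE /= => /andP[/eqP -> _].
by [].
Qed.

Lemma rnorm_ge0 V (x : V) : 0 <= rnorm x.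
Proof. by rewrite -lecR -norm_rnorm normr_ge0. Qed.

Lemma rnorm0 V : rnorm (0 : V) = 0.
Proof. by rewrite /rnorm normr0. Qed.

Lemma rnorm_eq0 V (x : V) : rnorm x = 0 -> x = 0.
Proof. by move=> h; apply/normr0_eq0; rewrite norm_rnorm h. Qed.

Lemma rnormD V (x y : V) : rnorm (x + y) <= rnorm x + rnorm y.
Proof. by rewrite -lecR rmorphD /= -!norm_rnorm ler_normD. Qed.

Lemma rnormN V (x : V) : rnorm (- x) = rnorm x.
Proof. by rewrite /rnorm normrN. Qed.

Lemma rnormB V (x y : V) : rnorm (x - y) <= rnorm x + rnorm y.
Proof. by rewrite -(rnormN y) rnormD. Qed.

Lemma rdistC V (x y : V) : rnorm (x - y) = rnorm (y - x).
Proof. by rewrite -rnormN opprB. Qed.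

Lemma rnormZ V (a : R[i]) (x : V) : rnorm (a *: x) = complex.Re `|a| * rnorm x.
Proof.
apply: (@complexI R); rewrite rmorphM /= -!norm_rnorm normrZ; congr (_ * _); exact: (norm_rnorm (a : R[i]^o)).
Qed.

Lemma normCR (t : R) : complex.Re `|t%:C| = `|t|.
Proof. by rewrite normc_def /= expr0n /= addr0 sqrtr_sqr. Qed.

Lemma normCi : complex.Re `|('i : R[i])| = 1.
Proof. by rewrite normc_def /= expr0n /= add0r expr1n sqrtr1. Qed.

End RealNorm.

Section Cstar.
Context {R : realType} {A : cstarType R}.
Implicit Types (x y z : A) (s t : R).

Lemma rnormM x y : rnorm (x * y) <= rnorm x * rnorm y.
Proof. by rewrite -lecR rmorphM /= -!norm_rnorm cstar_normM_le. Qed.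

Lemma starM x y : star (x * y) = star y * star x.
Proof. exact: cstar_starM. Qed.

Lemma rnorm_starM x : rnorm (star x * x) = rnorm x ^+ 2.
Proof. by apply: (@complexI R); rewrite rmorphXn /= -!norm_rnorm cstar_norm_starM. Qed.

Lemma star0 : star 0 = 0 :> A.
Proof. by apply: (addrI (star 0)); rewrite -starD !addr0. Qed.

Lemma starN x : star (- x) = - star x.
Proof. by apply/eqP; rewrite -addr_eq0 -starD addNr star0. Qed.

Lemma starB x y : star (x - y) = star x - star y.
Proof. by rewrite starD starN. Qed.

Lemma star1 : star 1 = 1 :> A.
Proof. by rewrite -[LHS]mul1r -[in RHS](starK 1) -[in RHS](mul1r (star 1)) starM starK. Qed.

Lemma rnorm_star x : rnorm (star x) = rnorm x.
Proof.
suff h y : rnorm y <= rnorm (star y) by apply/eqP; rewrite eq_le h andbT -{2}(starK x) h.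
have [->|y0] := eqVneq (rnorm y) 0; first exact: rnorm_ge0.
have y1 : 0 < rnorm y by rewrite lt_def y0 rnorm_ge0.
by rewrite -(ler_pM2r y1) -expr2 -rnorm_starM rnormM.
Qed.

(** Real scalars are handled as central elements of A, so that identities
    involving them are plain ring identities. *)
Definition sc t : A := t%:C *: (1 : A).

Lemma scE t x : t%:C *: x = sc t * x.
Proof. by have := cstar_scaleAl t%:C (1 : A) x; rewrite -[cstar_mul _ x]/(_ * x) mul1r => ->. Qed.

Lemma scC t x : sc t * x = x * sc t.
Proof.
rewrite -scE -{1}[x]mulr1.
exact: cstar_scaleAr.
Qed.

Lemma scD s t : sc (s + t) = sc s + sc t.
Proof. by rewrite /sc rmorphD scalerDl. Qed.
Lemma scN s : sc (- s) = - sc s.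
Proof. by rewrite /sc rmorphN scaleNr. Qed.
Lemma scB s t : sc (s - t) = sc s - sc t.
Proof. by rewrite scD scN. Qed.
Lemma scM s t : sc (s * t) = sc s * sc t.
Proof. by rewrite -scE /sc rmorphM scalerA. Qed.
Lemma sc0 : sc 0 = 0.
Proof. by rewrite /sc scale0r. Qed.
Lemma sc1 : sc 1 = 1.
Proof. by rewrite /sc scale1r. Qed.
Lemma star_sc t : star (sc t) = sc t.
Proof. by rewrite /sc starZ star1; congr (_ *: _); rewrite conj_Creal // complex_real eqxx. Qed.

(** Equality may fail: A can be the zero algebra. *)
Lemma rnorm1 : rnorm (1 : A) <= 1.
Proof.
have := rnorm_starM 1; rewrite star1 mul1r expr2.
have := rnorm_ge0 (1 : A); nra.
Qed.

Lemma rnorm_scM t x : rnorm (sc t * x) = `|t| * rnorm x.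
Proof. by rewrite -scE rnormZ normCR. Qed.

Lemma rnorm_sc t : rnorm (sc t) <= `|t|.
Proof. by rewrite -[sc t]mulr1 rnorm_scM ler_piMr // rnorm1. Qed.

(** The imaginary unit, as a central element of A. *)
Definition iu : A := 'i *: (1 : A).
Lemma iuE x : 'i *: x = iu * x.
Proof. by have := cstar_scaleAl 'i (1 : A) x; rewrite -[cstar_mul _ x]/(_ * x) mul1r => ->. Qed.
Lemma iuC x : iu * x = x * iu.
Proof. rewrite -iuE -{1}[x]mulr1; exact: cstar_scaleAr. Qed.
Lemma iu2 : iu * iu = -1.
Proof. by rewrite -iuE /iu scalerA -expr2 sqr_i scaleN1r. Qed.
Lemma star_iu : star iu = - iu.
Proof.
rewrite /iu starZ star1 -scaleNr; congr (_ *: _); apply/eqP.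
by rewrite eq_complex /= oppr0 !eqxx.
Qed.

End Cstar.

(** * Norm convergence of sequences *)
Lemma complex_gt0P (R : realType) (e : R[i]) : 0 < e -> exists2 e', 0 < e' & e = e'%:C.
Proof.
case: e => a b; rewrite ltcE /= => /andP[/eqP -> a0].
by exists a.
Qed.

Section Conv.
Context {R : realType} {A : cstarType R}.
Implicit Types (x y z : A) (u v : nat -> A).

Definition conv u x := forall e : R, 0 < e -> exists K, forall k, (K <= k)%N -> rnorm (u k - x) < e.

Definition cauchy_seq u := forall e : R, 0 < e -> exists K, forall k m, (K <= k)%N -> (k <= m)%N ->
  rnorm (u m - u k) < e.

Lemma cauchy_conv u : cauchy_seq u -> exists x, conv u x.
Proof.
move=> cu.
have [x ux] : exists x : A, u @ \oo --> x.
  apply/cvg_ex/cauchy_cvgP/cauchy_exP => e /complex_gt0P[e' e0 ->].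
  have [K hK] := cu _ e0; exists (u K).
  exists K => // m /= Km; rewrite -ball_normE /ball_ /= norm_rnorm ltcR rdistC.
  exact: hK.
exists x => e e0; have e0' : 0 < e%:C by rewrite ltcR.
move/cvgrPdist_lt/(_ _ e0') : ux => [K _ hK].
by exists K => k Kk; have := hK k Kk; rewrite /= norm_rnorm ltcR rdistC.
Qed.

Lemma closed_conv (T : set A) u x : closed T -> (forall k, T (u k)) -> conv u x -> T x.
Proof.
move=> cT Tu ux; apply: cT => B /nbhs_ballP[e /= /complex_gt0P[e' e0 ->] eB].
have [K hK] := ux _ e0; exists (u K); split => //; apply: eB.
by rewrite -ball_normE /ball_ /= norm_rnorm ltcR rdistC hK.
Qed.

Lemma small_eq0 x : (forall e : R, 0 < e -> rnorm x <= e) -> x = 0.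
Proof.
move=> h; apply: rnorm_eq0; apply/eqP; rewrite eq_le rnorm_ge0 andbT.
by apply/ler_addgt0Pl => e e0; rewrite addr0; apply: h.
Qed.

Lemma conv_uniq u x y : conv u x -> conv u y -> x = y.
Proof.
move=> ux uy; apply/eqP; rewrite -subr_eq0; apply/eqP; apply: small_eq0 => e e0.
have e20 : 0 < e / 2 by lra.
have [K hK] := ux _ e20; have [L hL] := uy _ e20.
have h1 := hK _ (leq_maxl K L); have h2 := hL _ (leq_maxr K L).
set w := u _ in h1 h2.
rewrite -(subrKA w) (le_trans (rnormD _ _))// -rnormN opprB; lra.
Qed.

Lemma conv_cst x : conv (fun=> x) x.
Proof. by move=> e e0; exists 0%N => k _; rewrite subrr rnorm0. Qed.

Lemma convD u v x y : conv u x -> conv v y -> conv (fun k => u k + v k) (x + y).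
Proof.
move=> ux uy e e0.
have e20 : 0 < e / 2 by lra.
have [K hK] := ux _ e20; have [L hL] := uy _ e20.
exists (maxn K L) => k; rewrite geq_max => /andP[/hK h1 /hL h2].
rewrite opprD addrACA (le_lt_trans (rnormD _ _))//; lra.
Qed.

Lemma convM u v x y : conv u x -> conv v y -> conv (fun k => u k * v k) (x * y).
Proof.
move=> ux uy e e0.
set C := rnorm x + rnorm y + 1.
have C0 : 1 <= C by have := rnorm_ge0 x; have := rnorm_ge0 y; rewrite /C; lra.
set d := Num.min 1 (e / (2 * C)).
have d0 : 0 < d by rewrite lt_min ltr01 divr_gt0 //; lra.
have d1 : d <= 1 by rewrite ge_min lexx.
have d2 : d * (2 * C) <= e by rewrite -ler_pdivlMr ?ge_min ?lexx ?orbT //; lra.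
have [K hK] := ux _ d0; have [L hL] := uy _ d0.
exists (maxn K L) => k; rewrite geq_max => /andP[/hK h1 /hL h2].
have -> : u k * v k - x * y = (u k - x) * (v k - y) + ((u k - x) * y + x * (v k - y)).
  by rewrite addrA -mulrDr subrK mulrBl mulrBr addrA subrK.
apply: le_lt_trans (rnormD _ _) _.
have h3 := rnormD ((u k - x) * y) (x * (v k - y)).
have h4 := rnormM (u k - x) (v k - y).
have h5 := rnormM (u k - x) y.
have h6 := rnormM x (v k - y).
have n1 := rnorm_ge0 (u k - x); have n2 := rnorm_ge0 (v k - y).
have n3 := rnorm_ge0 x; have n4 := rnorm_ge0 y.
move: h1 h2 h3 h4 h5 h6 n1 n2 n3 n4 d2.
rewrite /C.
move: (rnorm (u k - x)) (rnorm (v k - y)) (rnorm x) (rnorm y) => a b c f.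
move=> h1 h2 h3 h4 h5 h6 n1 n2 n3 n4 d2.
have q1 : a * b <= d by nra.
have q2 : a * f <= d * f by nra.
have q3 : c * b <= c * d by nra.
nra.
Qed.

Lemma conv_star u x : conv u x -> conv (fun k => star (u k)) (star x).
Proof.
move=> ux e /ux[K hK]; exists K => k /hK; by rewrite -starB rnorm_star.
Qed.

Lemma conv_le u x c : (forall k, rnorm (u k) <= c) -> conv u x -> rnorm x <= c.
Proof.
move=> h ux; apply/ler_addgt0Pl => e /ux[K /(_ K (leqnn K)) hK].
rewrite -(subrK (u K) x); apply: le_trans (rnormD _ _) _.
by rewrite lerD ?h // rdistC ltW.
Qed.

Lemma convS u x : conv u x -> conv (fun k => u k.+1) x.
Proof. by move=> ux e /ux[K hK]; exists K => k Kk; apply: hK; apply: leq_trans (leqnSn _). Qed.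

End Conv.

(** * Square roots by iteration *)

(** A square root of 1 - a is 1 - w, where w solves w = (a + w^2) / 2.  The
    fixed-point iteration from 0 is dominated by its scalar instance a = 1, which
    increases and stays in [0, 1], hence is Cauchy.  The ring and the way of
    bounding its elements are abstract because the same estimate serves in A,
    with its norm, and in matrices over A, with bounds stated by the order. *)
Section Iteration.
Context {R : realType}.

(** The iteration for a = 1. *)
Definition majorant k : R := iter k (fun w => (1 + w * w) / 2) 0.

Lemma majorant_itv k : 0 <= majorant k <= 1.
Proof. elim: k => [|k /andP[h1 h2]] /=; first by rewrite lexx ler01. by apply/andP; split; nra. Qed.

Lemma majorant_step k : majorant k <= majorant k.+1.
Proof. rewrite /=; have := majorant_itv k; have := sqr_ge0 (majorant k - 1); rewrite expr2; nra. Qed.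

Lemma majorant_mono k m : (k <= m)%N -> majorant k <= majorant m.
Proof.
move=> /subnK <-; elim: (m - k)%N => // n; rewrite addSn => /le_trans; apply.
exact: majorant_step.
Qed.

Lemma majorant_cauchy (e : R) : 0 < e ->
  exists K, forall k m, (K <= k)%N -> (k <= m)%N -> majorant m - majorant k < e.
Proof.
move=> e0; have hs : has_sup (range majorant).
  by split; [exists (majorant 0); exists 0%N|exists 1 => _ [k _ <-]; have /andP[] := majorant_itv k].
have [_ [K _ <-] hK] := sup_adherent e0 hs.
exists K => k m Kk km.
have h1 : majorant m <= sup (range majorant) by apply: ub_le_sup; [exact: hs.2|exists m].
have := majorant_mono Kk; lra.
Qed.

Variables (B : pzRingType) (h a : B) (bounded_by : R -> B -> Prop).
Definition root_iter k : B := iter k (fun w => h * (a + w * w)) 0.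

Hypothesis bounded_by0 : bounded_by 0 0.
Hypothesis bounded_byD : forall s t x y,
  bounded_by s x -> bounded_by t y -> bounded_by (s + t) (x + y).
Hypothesis bounded_byM : forall s t x y,
  bounded_by s x -> bounded_by t y -> bounded_by (s * t) (x * y).
Hypothesis bounded_by_half : bounded_by (2^-1) h.
Hypothesis bounded_by_a : bounded_by 1 a.

Lemma root_iter_bound k : bounded_by (majorant k) (root_iter k).
Proof.
elim: k => //= k ih; rewrite mulrC.
by apply/bounded_byM => //; apply/bounded_byD => //; apply/bounded_byM.
Qed.

Lemma root_iter_step k : bounded_by (majorant k.+1 - majorant k) (root_iter k.+1 - root_iter k).
Proof.
elim: k => [|k ih].
  rewrite /= !mulr0 !addr0 !subr0 mulrC; exact: bounded_byM.
have -> : root_iter k.+2 - root_iter k.+1 =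
  h * (root_iter k.+1 * (root_iter k.+1 - root_iter k) +
       (root_iter k.+1 - root_iter k) * root_iter k).
  rewrite [root_iter k.+2]/= [X in _ - X]/= -/(root_iter k.+1) -mulrBr; congr (_ * _).
  by rewrite mulrBr mulrBl addrA subrK opprD addrACA subrr add0r.
have -> : majorant k.+2 - majorant k.+1 =
  2^-1 * (majorant k.+1 * (majorant k.+1 - majorant k) +
          (majorant k.+1 - majorant k) * majorant k).
  have omS n : majorant n.+1 = (1 + majorant n * majorant n) / 2 by [].
  by rewrite (omS k.+1) (omS k); field.
by apply/bounded_byM => //; apply/bounded_byD; apply/bounded_byM => //; apply/root_iter_bound.
Qed.

Lemma root_iter_diff k m : (k <= m)%N ->
  bounded_by (majorant m - majorant k) (root_iter m - root_iter k).
Proof.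
move=> /subnK <-; elim: (m - k)%N => [|n ih]; first by rewrite add0n !subrr.
rewrite addSn -(subrKA (root_iter (n + k))) -(subrKA (majorant (n + k))).
by apply/bounded_byD => //; apply/root_iter_step.
Qed.
End Iteration.

Section Sqrt.
Context {R : realType} {A : cstarType R}.
Implicit Types (x y z a : A) (s t : R) (T : set A).

(** Sequential closedness passes more easily than topological closedness to
    commutants and to the set of self-adjoint elements. *)
Definition seq_closed T := forall u x, (forall k, T (u k)) -> conv u x -> T x.

(** The last clause locates w in any closed set stable under the iteration; it
    gives self-adjointness, commutation and membership in subalgebras at
    once. *)
Lemma sqrt_one_sub a : rnorm a <= 1 -> exists w : A, [/\ rnorm w <= 1,
  (1 - w) * (1 - w) = 1 - a & forall T, seq_closed T -> T 0 ->
    (forall u, T u -> T (sc (2^-1) * (a + u * u))) -> T w].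
Proof.
move=> a1.
pose bounded_by (s : R) (x : A) := rnorm x <= s.
pose h : A := sc (2^-1).
have b0 : bounded_by 0 0 by rewrite /bounded_by rnorm0.
have bD s t x y : bounded_by s x -> bounded_by t y -> bounded_by (s + t) (x + y).
  by move=> h1 h2; apply: le_trans (rnormD _ _) _; rewrite lerD.
have bM s t x y : bounded_by s x -> bounded_by t y -> bounded_by (s * t) (x * y).
  by move=> h1 h2; apply: le_trans (rnormM _ _) _; rewrite ler_pM ?rnorm_ge0.
have bh : bounded_by (2^-1) h.
  by apply: le_trans (rnorm_sc _) _; rewrite ger0_norm // invr_ge0.
have [w hw] : exists w, conv (root_iter h a) w.
  apply: cauchy_conv => e /majorant_cauchy[K hK]; exists K => k m Kk km.
  exact: le_lt_trans (root_iter_diff b0 bD bM bh a1 km) (hK _ _ Kk km).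
exists w; split.
- apply: conv_le hw => k; apply: le_trans (root_iter_bound b0 bD bM bh a1 k) _.
  by have /andP[] := majorant_itv (R := R) k.
- have e : w = h * (a + w * w).
    apply: conv_uniq (convS hw) _ => /=.
    apply: (convM (conv_cst h)); apply: (convD (conv_cst a)); exact: convM.
  have : w + w = a + w * w.
    by rewrite {1 2}e -mulrDl -scD (_ : 2^-1 + 2^-1 = 1 :> R) ?sc1 ?mul1r //; field.
  rewrite mulrBr mulr1 mulrBl mul1r opprB addrA => e2.
  have -> : a = w + w - w * w by rewrite e2 addrK.
  ncring.
- move=> T cT T0 Ts; apply: cT hw => k.
  by elim: k => //= k ih; apply: Ts.
Qed.

(** Sets that contain the functional calculus of their elements.  Involution is
    left out so that commutants of a single element qualify. *)
Definition closed_alg T := [/\ seq_closed T, T 1, forall s x y, T x -> T y -> T (sc s * x + y)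
  & forall x y, T x -> T y -> T (x * y)].

Lemma closed_alg0 T : closed_alg T -> T 0.
Proof. by move=> [_ T1 TD _]; have := TD (-1) 1 1 T1 T1; rewrite scN sc1 mulN1r addNr. Qed.
Lemma closed_algD T x y : closed_alg T -> T x -> T y -> T (x + y).
Proof. by move=> [_ T1 TD _] Tx Ty; have := TD 1 _ _ Tx Ty; rewrite sc1 mul1r. Qed.
Lemma closed_algS T s x : closed_alg T -> T x -> T (sc s * x).
Proof. by move=> cT Tx; have [_ _ TD _] := cT; have := TD s _ _ Tx (closed_alg0 cT); rewrite addr0. Qed.
Lemma closed_algN T x : closed_alg T -> T x -> T (- x).
Proof. by move=> cT Tx; rewrite -mulN1r -sc1 -scN; apply: closed_algS. Qed.
Lemma closed_algB T x y : closed_alg T -> T x -> T y -> T (x - y).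
Proof. by move=> cT Tx Ty; apply: closed_algD => //; apply: closed_algN. Qed.
Lemma closed_algM T x y : closed_alg T -> T x -> T y -> T (x * y).
Proof. by case=> _ _ _; apply. Qed.
Lemma closed_alg1 T : closed_alg T -> T 1.
Proof. by case. Qed.
Lemma closed_algsc T s : closed_alg T -> T (sc s).
Proof. by move=> cT; rewrite -[sc s]mulr1; apply: closed_algS => //; apply: closed_alg1. Qed.

Lemma closed_alg_subalgebra (D : set A) : cstar_subalgebra D -> closed_alg D.
Proof.
case=> D1 DD DM _ cD; split => //; first by move=> u x; apply: closed_conv.
by move=> s x y Dx Dy; rewrite -scE; apply: DD.
Qed.

Lemma closed_alg_commutant (S : set A) : closed_alg [set y | forall b, S b -> y * b = b * y].
Proof.
split => /=.
- move=> u x Tu ux b Sb; apply: conv_uniq (convM ux (conv_cst b)) _.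
  rewrite (_ : (fun k => u k * b) = fun k => b * u k).
    exact: (convM (conv_cst b) ux).
  by apply/funext => k; apply: Tu.
- by move=> b _; rewrite mul1r mulr1.
- by move=> s x y hx hy b Sb; rewrite mulrDl mulrDr -mulrA hx // hy // !mulrA scC.
- by move=> x y hx hy b Sb; rewrite -mulrA hy // mulrA hx // mulrA.
Qed.

Lemma closed_alg_comm b : closed_alg [set y | y * b = b * y].
Proof.
have := closed_alg_commutant [set b]; congr (closed_alg _); apply/seteqP; split => y /=.
  by apply.
by move=> h _ ->.
Qed.

Lemma sa_seq_closed : seq_closed [set y | star y = y].
Proof.
move=> u x /= h ux; apply: conv_uniq (conv_star ux) _.
by rewrite (_ : (fun k => star (u k)) = u)//; apply/funext.
Qed.

Lemma sa_sqrt_one_sub a : rnorm a <= 1 -> star a = a -> exists w, [/\ rnorm w <= 1, star w = w,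
   (1 - w) * (1 - w) = 1 - a & forall T, closed_alg T -> T a -> T w].
Proof.
move=> /sqrt_one_sub[w [w1 ww hw]] sa; exists w; split => //.
  apply: (hw [set y | star y = y]); rewrite /= ?star0 //; first exact: sa_seq_closed.
  by move=> u su; rewrite starM star_sc scC starD starM su sa.
move=> T cT Ta; apply: hw; [by case: cT|exact: closed_alg0|move=> u Tu].
by apply: closed_algS => //; apply: closed_algD => //; apply: closed_algM.
Qed.
End Sqrt.

(** * The positive cone *)
Section Pos.
Context {R : realType} {A : cstarType R}.
Implicit Types (x y z a u v w : A) (s t : R) (T : set A).

(** Positivity in the form that makes sums of positive elements positive by the
    triangle inequality; [posP] identifies it with being some z^* z. *)
Definition pos x := star x = x /\ exists2 t, 0 <= t & rnorm (sc t - x) <= t.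

Lemma posD x y : pos x -> pos y -> pos (x + y).
Proof.
move=> [sx [s s0 hs]] [sy [t t0 ht]]; split; first by rewrite starD sx sy.
exists (s + t); first exact: addr_ge0.
by rewrite scD opprD addrACA (le_trans (rnormD _ _))// lerD.
Qed.

Lemma posS s x : 0 <= s -> pos x -> pos (sc s * x).
Proof.
move=> s0 [sx [t t0 ht]]; split; first by rewrite starM sx star_sc scC.
exists (s * t); first exact: mulr_ge0.
by rewrite scM -mulrBr rnorm_scM ger0_norm // ler_wpM2l.
Qed.

Lemma pos_sc s : 0 <= s -> pos (sc s).
Proof. by move=> s0; split; [exact: star_sc|exists s; rewrite ?subrr ?rnorm0]. Qed.

Lemma pos0 : pos 0.
Proof. by rewrite -sc0; apply: pos_sc. Qed.

(** The C*-identity for the normal element u + i v, whose real part is u. *)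
Lemma commuting_squares (u v : A) t : 0 <= t -> star u = u -> star v = v -> u * v = v * u ->
  u * u + v * v = sc t -> rnorm u ^+ 2 <= t.
Proof.
move=> t0 su sv uv e; pose w := u + iu * v.
have sw : star w = u - iu * v by rewrite /w starD starM su sv star_iu mulrN iuC.
have ww : star w * w = sc t.
  rewrite -e sw /w.
  have -> : (u - iu * v) * (u + iu * v) = u * u + (u * iu - iu * u) * v
      + iu * (u * v - v * u) - iu * (v * iu - iu * v) * v - iu * iu * (v * v) by ncring.
  by rewrite -(iuC u) -(iuC v) uv iu2 !subrr !(mulr0, mul0r) subr0 !addr0 mulN1r opprK.
have : rnorm w ^+ 2 <= t.
  by rewrite -rnorm_starM ww (le_trans (rnorm_sc _))// ger0_norm.
apply: le_trans; rewrite lerXn2r ?nnegrE ?rnorm_ge0 //.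
have -> : u = sc (2^-1) * (w + star w).
  rewrite sw /w; have -> : u + iu * v + (u - iu * v) = u + u by ncring.
  by rewrite mulrDr -mulrDl -scD (_ : 2^-1 + 2^-1 = 1 :> R) ?sc1 ?mul1r //; field.
rewrite rnorm_scM ger0_norm ?invr_ge0 //; have := rnormD w (star w); rewrite rnorm_star; lra.
Qed.

(** The squares of u and of the root of 1 - u^2 add up to 1. *)
Lemma norm_one_sub_sq u : star u = u -> rnorm u <= 1 -> rnorm (1 - u * u) <= 1.
Proof.
move=> su u1; have [||w [w1 sw ww hw]] := sa_sqrt_one_sub (a := u * u).
- by apply: le_trans (rnormM _ _) _; have := rnorm_ge0 u; nra.
- by rewrite starM su.
have uw : w * u = u * w by apply: (hw _ (closed_alg_comm u)); rewrite /= mulrA.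
rewrite -ww -[X in X * _](_ : star (1 - w) = _) ?rnorm_starM; last by rewrite starB star1 sw.
apply: (commuting_squares ler01 _ su); first by rewrite starB star1 sw.
  by rewrite mulrBl mulrBr mul1r mulr1 uw.
by rewrite ww subrK sc1.
Qed.

Lemma scVK t x : t != 0 -> sc t * (sc t^-1 * x) = x.
Proof. by move=> t0; rewrite mulrA -scM divff // sc1 mul1r. Qed.

Lemma scMM s t x y : sc s * x * (sc t * y) = sc (s * t) * (x * y).
Proof. by rewrite scM -!mulrA; congr (_ * _); rewrite !mulrA scC. Qed.

Lemma pos_sq u : star u = u -> pos (u * u).
Proof.
move=> su; split; first by rewrite starM su.
have [/rnorm_eq0 ->|c0] := eqVneq (rnorm u) 0.
  by exists 0; rewrite // sc0 mul0r subr0 rnorm0.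
have c1 : 0 < rnorm u by rewrite lt_def c0 rnorm_ge0.
set c := rnorm u in c0 c1; exists (c * c); first by rewrite mulr_ge0 // ltW.
set v := sc c^-1 * u.
have sv : star v = v by rewrite /v starM star_sc su scC.
have v1 : rnorm v <= 1 by rewrite /v rnorm_scM ger0_norm ?invr_ge0 ?rnorm_ge0 // -/c mulVf ?lexx.
have eu : u = sc c * v by rewrite scVK.
have -> : sc (c * c) - u * u = sc (c * c) * (1 - v * v).
  by rewrite mulrBr mulr1 -scMM -eu.
have := norm_one_sub_sq sv v1.
have cc : 0 <= c * c by apply: mulr_ge0; apply: ltW.
by move=> h; rewrite rnorm_scM ger0_norm // ler_piMr.
Qed.

Lemma pos_sqrt x : pos x -> exists u, [/\ star u = u, u * u = x & forall T, closed_alg T -> T x -> T u].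
Proof.
move=> [sx [t]]; rewrite le_eqVlt => /orP[/eqP <-|t0 ht].
  rewrite sc0 sub0r rnormN => h.
  have -> : x = 0 by apply: rnorm_eq0; apply/eqP; rewrite eq_le h rnorm_ge0.
  by exists 0; rewrite star0 mul0r; split.
have tn : t != 0 by rewrite gt_eqF.
have [||w [w1 sw ww hw]] := sa_sqrt_one_sub (a := 1 - sc t^-1 * x).
- have -> : 1 - sc t^-1 * x = sc t^-1 * (sc t - x) by rewrite mulrBr -scM mulVf // sc1.
  by rewrite rnorm_scM ger0_norm ?invr_ge0 ?(ltW t0) // ler_pdivrMl // mulr1.
- by rewrite starB star1 starM star_sc sx scC.
have q : Num.sqrt t * Num.sqrt t = t by rewrite -expr2 sqr_sqrtr // ltW.
exists (sc (Num.sqrt t) * (1 - w)); split.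
- by rewrite starM star_sc starB star1 sw scC.
- rewrite -!mulrA [X in _ * X]mulrA -scC -!mulrA mulrA -scM q ww opprB addrC subrK.
  exact: scVK.
- move=> T cT Tx; apply: closed_algS => //; apply: closed_algB => //; first exact: closed_alg1.
  by apply: hw => //; apply: closed_algB => //; [exact: closed_alg1|exact: closed_algS].
Qed.

Lemma pos_sa x : pos x -> star x = x. Proof. by case. Qed.

Lemma comm_sqrt x u y : (forall T, closed_alg T -> T x -> T u) -> x * y = y * x -> u * y = y * u.
Proof. by move=> h xy; apply: (h _ (closed_alg_comm y)). Qed.

Lemma sq_eq0 u : star u = u -> u * u = 0 -> u = 0.
Proof.
move=> su uu; apply: rnorm_eq0; apply/eqP; rewrite -sqrf_eq0 -rnorm_starM su uu.
by rewrite rnorm0.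
Qed.

Lemma starM_eq0 z : star z * z = 0 -> z = 0.
Proof.
move=> uu; apply: rnorm_eq0; apply/eqP; rewrite -sqrf_eq0 -rnorm_starM uu.
by rewrite rnorm0.
Qed.

Lemma posM x y : pos x -> pos y -> x * y = y * x -> pos (x * y).
Proof.
move=> /pos_sqrt[u [su <- hu]] /pos_sqrt[v [sv <- hv]] xy.
have uy := comm_sqrt hu xy; have uv : u * v = v * u.
  by apply/esym; apply: (comm_sqrt hv); rewrite uy.
have -> : u * u * (v * v) = (u * v) * (u * v).
  by rewrite -!mulrA; congr (_ * _); rewrite !mulrA uv.
by apply: pos_sq; rewrite starM su sv.
Qed.

Lemma pos_anti x : pos x -> pos (- x) -> x = 0.
Proof.
move=> /pos_sqrt[u [su <- hu]] /pos_sqrt[v [sv hx hv]].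
have uv : u * v = v * u.
  by apply/esym; apply: (comm_sqrt hv); rewrite mulNr mulrN mulrA.
have := commuting_squares (lexx 0) su sv uv.
rewrite hx subrr sc0 => /(_ erefl) h.
have -> : u = 0; last by rewrite mul0r.
apply: rnorm_eq0; have := rnorm_ge0 u; nra.
Qed.

Lemma le_sc x t : star x = x -> rnorm x <= t -> pos (sc t - x).
Proof.
move=> sx xt; split; first by rewrite starB star_sc sx.
exists t; first exact: le_trans (rnorm_ge0 x) xt.
by rewrite opprB addrC subrK.
Qed.

Lemma norm_le x t : 0 <= t -> pos x -> pos (sc t - x) -> rnorm x <= t.
Proof.
move=> t0 /pos_sqrt[u [su <- hu]] /pos_sqrt[v [sv hx hv]].
have uv : u * v = v * u.
  apply/esym; apply: (comm_sqrt hv); by rewrite mulrBl mulrBr scC mulrA.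
rewrite -[X in X * _]su rnorm_starM; apply: commuting_squares su sv uv _ => //.
by rewrite hx addrC subrK.
Qed.

Lemma norm_mono x y : pos x -> pos (y - x) -> rnorm x <= rnorm y.
Proof.
move=> px pyx; apply: norm_le => //; first exact: rnorm_ge0.
have -> : sc (rnorm y) - x = (sc (rnorm y) - y) + (y - x) by rewrite subrKA.
apply: posD => //; apply: le_sc => //.
by have := pos_sa (posD px pyx); rewrite addrC subrK.
Qed.

Lemma order_norm x t : 0 <= t -> pos (sc t - x) -> pos (sc t + x) -> rnorm x <= t.
Proof.
move=> t0 p1 p2.
have sx : star x = x.
  by have := pos_sa p2; rewrite starD star_sc => /addrI.
have : rnorm (x * x) <= t * t.
  apply: norm_le; [exact: mulr_ge0|exact: pos_sq|].
  have -> : sc (t * t) - x * x = (sc t - x) * (sc t + x).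
    by rewrite scM mulrBl !mulrDr -(scC t x) opprD addrA addrK.
  apply: posM => //; rewrite mulrBl mulrBr !mulrDl !mulrDr -(scC t x).
  by ncring.
rewrite -[X in X * _]sx rnorm_starM; have := rnorm_ge0 x; nra.
Qed.

(** Two successive roots of x^2: r^2 is the absolute value of x. *)
Lemma pos_fourth_root x : star x = x -> exists r, [/\ star r = r, r * r * (r * r) = x * x
   & forall T, closed_alg T -> T x -> T r].
Proof.
move=> sx; have [/rnorm_eq0 ->|c0] := eqVneq (rnorm x) 0.
  by exists 0; rewrite star0 !mul0r; split.
have c1 : 0 < rnorm x by rewrite lt_def c0 rnorm_ge0.
set c := rnorm x in c0 c1.
set v := sc c^-1 * x.
have sv : star v = v by rewrite /v starM star_sc sx scC.
have v1 : rnorm v <= 1 by rewrite /v rnorm_scM ger0_norm ?invr_ge0 ?rnorm_ge0 // -/c mulVf ?lexx.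
have [||w [w1 sw ww hw]] := sa_sqrt_one_sub (a := 1 - v * v); first exact: norm_one_sub_sq.
  by rewrite starB star1 starM sv.
have [w' [w1' sw' ww' hw']] := sa_sqrt_one_sub w1 sw.
have q : Num.sqrt c * Num.sqrt c = c by rewrite -expr2 sqr_sqrtr // ltW.
exists (sc (Num.sqrt c) * (1 - w')); split.
- by rewrite starM star_sc starB star1 sw' scC.
- by rewrite !scMM q ww' ww opprB addrC subrK -scMM /v scVK.
- move=> T cT Tx; apply: closed_algS => //; apply: closed_algB => //; first exact: closed_alg1.
  apply: hw' => //; apply: hw => //; apply: closed_algB => //; first exact: closed_alg1.
  by apply: closed_algM => //; apply: closed_algS.
Qed.
End Pos.

(** * Positivity of z^* z, and positive and negative parts *)
Lemma gap_sqr (B : pzRingType) (x m : B) : m * m = x * x -> m * x = x * m ->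
  (m - x) * (m - x) = (m + m) * (m - x).
Proof.
move=> mx cmx.
have -> : (m - x) * (m - x) = m * m - m * x - x * m + x * x by ncring.
by rewrite -mx -cmx; ncring.
Qed.

Section Pos2.
Context {R : realType} {A : cstarType R}.
Implicit Types (x y z a m n c : A) (s t : R) (T : set A).

Lemma abs_exists x : star x = x -> exists m, [/\ pos m, m * m = x * x &
  forall T, closed_alg T -> T x -> T m].
Proof.
move=> /pos_fourth_root[r [sr rx hr]]; exists (r * r); split => //; first exact: pos_sq.
by move=> T cT Tx; apply: closed_algM => //; apply: hr.
Qed.

(** With m the absolute value of x, the gap m - x is twice the negative part of
    x.  Before its positivity is known, these identities do its work. *)
Section Gap.
Variables x m : A.
Hypotheses (sx : star x = x) (pm : pos m) (mx : m * m = x * x) (cmx : m * x = x * m).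
Let n := m - x.
Let sn : star n = n. Proof. by rewrite starB pm.1 sx. Qed.

Lemma gap_sq : n * n = (m + m) * n.
Proof. exact: gap_sqr. Qed.

Lemma gap_mul : x * n = - (m * n).
Proof. by rewrite /n !mulrBr opprB -mx cmx. Qed.

Lemma gap_comm : m * n = n * m.
Proof. by rewrite /n mulrBr mulrBl cmx. Qed.

Lemma gap_eq0 : m * n = 0 -> n = 0.
Proof. by move=> h; apply: sq_eq0 sn _; rewrite gap_sq mulrDl h addr0. Qed.

Lemma gap_eq0_sq : m * (n * n) = 0 -> n = 0.
Proof.
move=> h; apply: gap_eq0; apply: sq_eq0; first by rewrite starM sn pm.1 gap_comm.
by rewrite -mulrA [n * _]mulrA -gap_comm -mulrA h mulr0.
Qed.

Lemma pos_mnn : pos (m * (n * n)).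
Proof.
apply: posM => //; first exact: pos_sq.
by rewrite mulrA gap_comm -mulrA gap_comm mulrA.
Qed.
End Gap.

(** Let n be twice the negative part of x = z^* z and y = z n.  Then y^* y = - c
    with c = m n^2 >= 0, so that w = y y^* >= 0.  For v = 1 - q w with q > 0
    small, v is a contraction, and y^* v^k y = - c (1 + q c)^k is bounded in k;
    since (1 + q c)^k >= 1 + k q c, this forces c = 0, hence n = 0. *)
Lemma pos_starM z : pos (star z * z).
Proof.
set x := star z * z; have sx : star x = x by rewrite /x starM starK.
have [m [pm mx hm]] := abs_exists sx.
have cmx : m * x = x * m by apply: (hm _ (closed_alg_comm x)).
have cnm := gap_comm cmx; have pc := pos_mnn sx pm cmx.
have en := gap_eq0_sq sx pm mx cmx; have xn := gap_mul mx cmx.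
set n := m - x in cnm pc en xn.
have sn : star n = n by rewrite starB pm.1 sx.
suff h : n = 0 by have -> : x = m; [apply/esym/eqP; rewrite -subr_eq0 -/n h|].
apply: en; set c := m * (n * n) in pc *.
have [y yy] : exists y, star y * y = - c.
  by exists (z * n); rewrite starM sn -mulrA (mulrA (star z)) -/x xn mulrN mulrA -cnm /c mulrA.
clearbody c.
pose w := y * star y.
have pw : pos w.
  (* y y^* + y^* y is half the sum of the squares of y + y^* and i (y - y^* ). *)
  have -> : w = sc (2^-1) * ((y + star y) * (y + star y)
      + (iu * (y - star y)) * (iu * (y - star y)) + (c + c)).
    have -> : iu * (y - star y) * (iu * (y - star y)) = - ((y - star y) * (y - star y)).
      by rewrite -mulrA (mulrA (y - star y)) -iuC -mulrA mulrA iu2 mulN1r.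
    rewrite -[c]opprK -yy.
    have -> : (y + star y) * (y + star y) - (y - star y) * (y - star y) +
      (- (star y * y) - star y * y) = w + w by rewrite /w; ncring.
    by rewrite mulrDr -mulrDl -scD (_ : 2^-1 + 2^-1 = 1 :> R) ?sc1 ?mul1r //; field.
  apply: posS; first by rewrite invr_ge0.
  apply: posD; last exact: posD.
  apply: posD; apply: pos_sq; first by rewrite starD starK addrC.
  by rewrite starM starB starK star_iu mulrN -iuC -mulrN opprB.
have [_ [t t0 ht]] := pw.
(* t may vanish, t + 1 does not. *)
pose q := (t + 1)^-1.
have t1 : 0 < t + 1 by lra.
have q0 : 0 < q by rewrite invr_gt0.
pose v := 1 - sc q * w.
have v1 : rnorm v <= 1.
  have -> : v = sc q * (sc (t + 1) - w) by rewrite /v mulrBr -scM mulVf ?sc1 // gt_eqF.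
  rewrite rnorm_scM gtr0_norm // ler_pdivrMl // mulr1 scD addrAC.
  by apply: le_trans (rnormD _ _) _; apply: lerD => //; apply: le_trans (rnorm_sc _) _; rewrite normr1.
have vk k : rnorm (v ^+ k) <= 1.
  elim: k => [|k ih]; first by rewrite expr0 rnorm1.
  rewrite exprS; apply: le_trans (rnormM _ _) _.
  by have := rnorm_ge0 v; have := rnorm_ge0 (v ^+ k); nra.
pose g := 1 + sc q * c.
have vy k : v ^+ k * y = y * g ^+ k.
  elim: k => [|k ih]; first by rewrite !expr0 mul1r mulr1.
  rewrite exprS -mulrA ih mulrA (exprS g) mulrA; congr (_ * _).
  rewrite /v /g mulrBl mul1r mulrDr mulr1 /w -!mulrA yy !mulrN opprK.
  by rewrite (mulrA y) -(scC _ y) -mulrA.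
have cg : c * g = g * c by rewrite /g mulrDr mulrDl mul1r mulr1 scC -mulrA -scC.
have cgk k : c * g ^+ k = g ^+ k * c.
  by apply: commrX.
have bound k : rnorm (c * g ^+ k) <= rnorm y ^+ 2.
  rewrite -rnormN -mulNr -yy -mulrA -vy.
  apply: le_trans (rnormM _ _) _; rewrite rnorm_star expr2 ler_wpM2l ?rnorm_ge0 //.
  apply: le_trans (rnormM _ _) _; rewrite ler_piMl ?rnorm_ge0 //.
have pg : pos g by apply: posD; [rewrite -sc1; apply: pos_sc|apply: posS => //; apply: ltW].
have cc : pos (c * c) by apply: pos_sq; exact: pc.1.
have bern k : pos (g ^+ k - 1 - sc (k%:R * q) * c).
  elim: k => [|k ih]; first by rewrite expr0 subrr mul0r sc0 mul0r subrr; exact: pos0.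
  have -> : g ^+ k.+1 - 1 - sc (k.+1%:R * q) * c =
     g * (g ^+ k - 1 - sc (k%:R * q) * c) + sc (k%:R * q * q) * (c * c).
    rewrite exprS -natr1 (mulrDl k%:R) mul1r scD !mulrBr mulr1.
    have -> : g * (sc (k%:R * q) * c) = sc (k%:R * q) * c + sc (k%:R * q * q) * (c * c).
      by rewrite /g mulrDl mul1r scMM (mulrC q).
    by rewrite /g; ncring.
  apply: posD; last by apply: posS => //; rewrite !mulr_ge0 // ltW.
  apply: posM => //.
  have h1 : g * g ^+ k = g ^+ k * g by rewrite -exprS exprSr.
  by rewrite !mulrBr !mulrBl h1 mulr1 mul1r; congr (_ - _); rewrite mulrA -(scC _ g) -!mulrA cg.
have main k : k%:R * q * rnorm (c * c) <= rnorm y ^+ 2.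
  apply: le_trans (bound k).
  have kq : 0 <= k%:R * q by rewrite mulr_ge0 // ltW.
  rewrite -[X in X * rnorm _]ger0_norm // -rnorm_scM.
  apply: norm_mono; first exact: posS.
  have -> : c * g ^+ k - sc (k%:R * q) * (c * c) = c * (g ^+ k - 1 - sc (k%:R * q) * c) + c.
    by rewrite !mulrBr mulr1 [c * (sc _ * c)]mulrA -(scC _ c) -(mulrA (sc _) c); ncring.
  apply: posD => //; apply: posM => //.
  by rewrite !mulrBr !mulrBl cgk mulr1 mul1r; congr (_ - _); rewrite mulrA -(scC _ c) -!mulrA.
apply: sq_eq0; first exact: pc.1.
apply: rnorm_eq0; apply/eqP; rewrite eq_le rnorm_ge0 andbT leNgt; apply/negP => h.
have h2 : 0 < q * rnorm (c * c) by rewrite mulr_gt0.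
have := main (Num.bound (rnorm y ^+ 2 / (q * rnorm (c * c)))).
have := archi_boundP (x := rnorm y ^+ 2 / (q * rnorm (c * c))).
rewrite divr_ge0 ?exprn_ge0 ?rnorm_ge0 ?(ltW h2) // => /(_ isT).
by rewrite ltr_pdivrMr // mulrA => /lt_le_trans h3 /h3; rewrite ltxx.
Qed.

Lemma pos_conj z x : pos x -> pos (star z * x * z).
Proof.
move=> /pos_sqrt[u [su <- _]].
have -> : star z * (u * u) * z = star (u * z) * (u * z) by rewrite starM su !mulrA.
exact: pos_starM.
Qed.

Lemma posP x : pos x <-> exists z, x = star z * z.
Proof.
split=> [/pos_sqrt[u [su <- _]]|[z ->]]; last exact: pos_starM.
by exists u; rewrite su.
Qed.

(** With m the absolute value of x and n = m - x one has x n = - m n, so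
    n x^3 n = - n m^3 n; both n x^3 n and n m^3 n are positive, hence
    vanish, and so does n. *)
Lemma pos_cube x : star x = x -> pos (x * x * x) -> pos x.
Proof.
move=> sx p3; have [m [pm mx hm]] := abs_exists sx.
have cmx : m * x = x * m by apply: (hm _ (closed_alg_comm x)).
have cnm := gap_comm cmx; have en := gap_eq0_sq sx pm mx cmx.
have xn := gap_mul mx cmx; have pc := pos_mnn sx pm cmx.
set n := m - x in cnm en xn pc.
have sn : star n = n by rewrite starB pm.1 sx.
suff h : n = 0 by have -> : x = m; [apply/esym/eqP; rewrite -subr_eq0 -/n h|].
clearbody n.
apply: en.
have h1 := pos_conj n p3; rewrite sn in h1.
have x1 : x * (m * n) = - (m * (m * n)) by rewrite mulrA -cmx -mulrA xn mulrN.
have x2 : x * (m * (m * n)) = - (m * (m * (m * n))) by rewrite mulrA -cmx -mulrA x1 mulrN.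
have h2 : n * (x * x * x) * n = - (m * (m * (n * n)) * m).
  rewrite -!mulrA xn mulrN x1 opprK x2 mulrN -cnm.
  by do 4 rewrite (mulrA n m) -cnm -(mulrA m n).
rewrite h2 in h1.
have p4 : pos (m * (m * (n * n)) * m) by rewrite -{1}pm.1; apply: pos_conj.
have e0 := pos_anti p4 h1.
have [u [su uu hu]] := pos_sqrt pc.
have um : u * m = 0.
  by apply: starM_eq0; rewrite starM su pm.1 -mulrA (mulrA u) uu -e0 mulrA.
have cc : star (m * (n * n)) = m * (n * n) by exact: pc.1.
apply: sq_eq0 => //.
have : m * (n * n) * m = 0 by rewrite -uu -mulrA um mulr0.
by move=> h; rewrite mulrA h mul0r.
Qed.

(** The cube of n = m - x is 2 m n^2, a product of commuting positive
    elements. *)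
Lemma pos_abs_sub x m : star x = x -> pos m -> m * m = x * x -> m * x = x * m -> pos (m - x).
Proof.
move=> sx pm mx cmx; apply: pos_cube; first by rewrite starB pm.1 sx.
rewrite gap_sq // -mulrA mulrDl; have h := pos_mnn sx pm cmx.
exact: posD.
Qed.

Lemma pos_neg_parts x : star x = x -> exists xp xm, [/\ pos xp, pos xm, x = xp - xm,
  xp * xm = 0 & forall T, closed_alg T -> T x -> T xp /\ T xm].
Proof.
move=> sx; have [m [pm mx hm]] := abs_exists sx.
have cmx : m * x = x * m by apply: (hm _ (closed_alg_comm x)).
exists (sc (2^-1) * (m + x)), (sc (2^-1) * (m - x)).
have h0 : 0 <= 2^-1 :> R by rewrite invr_ge0.
split.
- apply: posS => //; rewrite -[x]opprK; apply: pos_abs_sub; rewrite ?starN ?sx ?mulrNN //.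
  by rewrite mulrN mulNr cmx.
- by apply: posS => //; apply: pos_abs_sub.
- rewrite -mulrBr; have -> : m + x - (m - x) = x + x by ncring.
  by rewrite mulrDr -mulrDl -scD (_ : 2^-1 + 2^-1 = 1 :> R) ?sc1 ?mul1r //; field.
- rewrite scMM; have -> : (m + x) * (m - x) = m * m - m * x + x * m - x * x by ncring.
  by rewrite cmx mx subrK subrr mulr0.
- move=> T cT Tx; have Tm := hm _ cT Tx.
  by split; apply: closed_algS => //; [apply: closed_algD|apply: closed_algB].
Qed.

Lemma pos_add_eq0 x y : pos x -> pos y -> x + y = 0 -> x = 0.
Proof. by move=> px py /eqP; rewrite addr_eq0 => /eqP e; apply: pos_anti => //; rewrite e opprK. Qed.
End Pos2.

(** * Matrices over a C*-algebra *)
Section MxAdj.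
Context {R : realType} {A : cstarType R}.
Lemma mxadjE m n (Y : 'M[A]_(m, n)) i j : mxadj Y i j = star (Y j i).
Proof. by rewrite /mxadj !mxE. Qed.
Lemma star_sum (J : Type) (r : seq J) (P : pred J) (F : J -> A) :
  star (\sum_(i <- r | P i) F i) = \sum_(i <- r | P i) star (F i).
Proof. exact: (big_morph _ (@starD R A) (@star0 R A)). Qed.
Lemma mxadjM m n p (Y : 'M[A]_(m, n)) (Z : 'M[A]_(n, p)) :
  mxadj (Y *m Z) = mxadj Z *m mxadj Y.
Proof.
apply/matrixP => i j; rewrite mxadjE !mxE star_sum; apply: eq_bigr => k _.
by rewrite starM !mxadjE.
Qed.
Lemma mxadjK m n (Y : 'M[A]_(m, n)) : mxadj (mxadj Y) = Y.
Proof. by apply/matrixP => i j; rewrite !mxadjE starK. Qed.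
Lemma mxadjD m n (Y Z : 'M[A]_(m, n)) : mxadj (Y + Z) = mxadj Y + mxadj Z.
Proof. by apply/matrixP => i j; rewrite [in RHS]mxE !mxadjE mxE starD. Qed.
Lemma mxadjN m n (Y : 'M[A]_(m, n)) : mxadj (- Y) = - mxadj Y.
Proof. by apply/matrixP => i j; rewrite [in RHS]mxE !mxadjE mxE starN. Qed.
Lemma mxadjB m n (Y Z : 'M[A]_(m, n)) : mxadj (Y - Z) = mxadj Y - mxadj Z.
Proof. by rewrite mxadjD mxadjN. Qed.
Lemma mxadj0 m n : mxadj (0 : 'M[A]_(m, n)) = 0.
Proof. by apply/matrixP => i j; rewrite mxadjE !mxE star0. Qed.
Lemma mxadj_scalar n (a : A) : mxadj (a%:M : 'M[A]_n) = (star a)%:M.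
Proof. by apply/matrixP => i j; rewrite mxadjE !mxE eq_sym; case: eqP => _ //=; rewrite star0. Qed.
End MxAdj.

Section PosClosed.
Context {R : realType} {A : cstarType R}.
Lemma pos_seq_closed : seq_closed (@pos R A).
Proof.
move=> u x pu ux; split; first by apply: sa_seq_closed ux => k; exact: (pu k).1.
have t0 := rnorm_ge0 x; pose t := rnorm x + 1; have t1 : 0 <= t by rewrite /t; lra.
exists t => //; apply/ler_addgt0Pl => e e0.
have e1 : 0 < Num.min e 1 by rewrite lt_min e0 ltr01.
have [K /(_ K (leqnn K)) hK] := ux _ e1.
have /andP[h1 h2] : (rnorm (u K - x) < e) && (rnorm (u K - x) < 1).
  by move: hK; rewrite lt_min.
have h3 : rnorm (u K) <= t.
  by rewrite -(subrK x (u K)) (le_trans (rnormD _ _))// /t; lra.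
have h4 : rnorm (sc t - u K) <= t.
  apply: norm_le => //; first by apply: le_sc => //; exact: (pu K).1.
  by rewrite opprB addrC subrK.
by rewrite -(subrKA (u K)) (le_trans (rnormD _ _))//; lra.
Qed.

Lemma pos_sum (J : Type) (r : seq J) (P : pred J) (F : J -> A) :
  (forall i, P i -> pos (F i)) -> pos (\sum_(i <- r | P i) F i).
Proof. by move=> h; elim/big_ind: _ => //; [exact: pos0|exact: posD]. Qed.

Lemma pos_sum_eq0 (J : finType) (F : J -> A) :
  (forall i, pos (F i)) -> \sum_i F i = 0 -> forall i, F i = 0.
Proof.
move=> h e i; apply: (@pos_add_eq0 _ _ _ (\sum_(j | j != i) F j)) => //; first exact: pos_sum.
by move: e; rewrite (bigD1 i).
Qed.

Lemma conv_sum (J : Type) (r : seq J) (F : J -> nat -> A) (l : J -> A) :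
  (forall i, conv (F i) (l i)) -> conv (fun k => \sum_(i <- r) F i k) (\sum_(i <- r) l i).
Proof.
move=> h; elim: r => [|i r ih].
  by rewrite big_nil (_ : (fun k => _) = fun=> 0) ; [exact: conv_cst|apply/funext => k; rewrite big_nil].
rewrite big_cons (_ : (fun k => _) = fun k => F i k + \sum_(j <- r) F j k); first exact: convD.
by apply/funext => k; rewrite big_cons.
Qed.
End PosClosed.

Section MxBound.
Context {R : realType} {A : cstarType R}.
Variable n : nat.
Implicit Types (s t : R) (X Y Z : 'M[A]_n) (v : 'cV[A]_n).

(** The A-valued inner product of v with itself in the Hilbert module A^n. *)
Definition inner_sq v : A := \sum_i star (v i 0) * v i 0.

Lemma pos_inner_sq v : pos (inner_sq v).
Proof. by apply: pos_sum => i _; apply: pos_starM. Qed.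

Lemma inner_sq_eq0 v : inner_sq v = 0 -> v = 0.
Proof.
move=> h; apply/matrixP => i j; rewrite ord1 mxE; apply: starM_eq0.
by apply: (pos_sum_eq0 _ h) => k; apply: pos_starM.
Qed.

Lemma inner_sqE v : inner_sq v = (mxadj v *m v) 0 0.
Proof. by rewrite mxE; apply: eq_bigr => i _; rewrite mxadjE. Qed.

(** Y has operator norm at most t on A^n.  Stating this with the order of A
    makes submultiplicativity immediate and avoids suprema. *)
Definition bounded_by t Y := 0 <= t /\ forall v, pos (sc (t * t) * inner_sq v - inner_sq (Y *m v)).

Lemma bounded_by0 : bounded_by 0 0.
Proof.
split=> // v; rewrite mulr0 sc0 mul0r mul0mx sub0r.
by rewrite /inner_sq big1 ?oppr0; [exact: pos0|move=> i _; rewrite mxE mulr0].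
Qed.

Lemma bounded_byM s t X Y : bounded_by s X -> bounded_by t Y -> bounded_by (s * t) (X * Y).
Proof.
move=> [s0 hs] [t0 ht]; split; first exact: mulr_ge0.
move=> v; rewrite -[X * Y]/(X *m Y) -mulmxA -(subrKA (sc (s * s) * inner_sq (Y *m v))).
apply: posD => //.
have -> : sc (s * t * (s * t)) * inner_sq v - sc (s * s) * inner_sq (Y *m v) =
   sc (s * s) * (sc (t * t) * inner_sq v - inner_sq (Y *m v)).
  by rewrite mulrBr [sc (s * s) * (_ * _)]mulrA -scM mulrACA.
by apply: posS => //; apply: mulr_ge0.
Qed.

(** The cross term c is controlled by the positivity of the inner square of
    t v - s w. *)
Lemma inner_sq_add (v w : 'cV[A]_n) s t : 0 < s -> 0 < t ->
  exists c, inner_sq (v + w) = inner_sq v + inner_sq w + c /\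
    pos (sc (t * t) * inner_sq v + sc (s * s) * inner_sq w - sc (s * t) * c).
Proof.
move=> s0 t0; exists (\sum_i (star (v i 0) * w i 0 + star (w i 0) * v i 0)); split.
  rewrite /inner_sq -!big_split /=; apply: eq_bigr => i _; rewrite !mxE starD; ncring.
rewrite /inner_sq !big_distrr /= -big_split /= -sumrB; apply: pos_sum => i _.
set a := v i 0; set b := w i 0.
have <- : star (sc t * a - sc s * b) * (sc t * a - sc s * b) =
  sc (t * t) * (star a * a) + sc (s * s) * (star b * b) - sc (s * t) * (star a * b + star b * a).
  rewrite starB !starM !star_sc -!scC mulrBl !mulrBr !scMM (mulrC t s) mulrDr; ncring.
exact: pos_starM.
Qed.

Lemma bounded_byD s t X Y : bounded_by s X -> bounded_by t Y -> bounded_by (s + t) (X + Y).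
Proof.
move=> [s0 hs] [t0 ht]; split; first exact: addr_ge0.
move=> v; rewrite mulmxDl.
have z0 u w : pos (sc (0 * 0) * inner_sq u - inner_sq w) -> w = 0.
  rewrite mul0r sc0 mul0r sub0r => h; apply: inner_sq_eq0; apply: pos_anti h; exact: pos_inner_sq.
move: s0 t0 hs ht; rewrite le_eqVlt => /orP[/eqP <- _ hs ht|s0].
  by rewrite (z0 _ _ (hs v)) !add0r.
rewrite le_eqVlt => /orP[/eqP <- hs ht|t0 hs ht].
  by rewrite (z0 _ _ (ht v)) !addr0.
have [c [-> pc]] := inner_sq_add (X *m v) (Y *m v) s0 t0.
have st : s * t != 0 by rewrite mulf_neq0 ?gt_eqF.
have scK z : z = sc (s * t)^-1 * (sc (s * t) * z) by rewrite mulrA -scM mulVf // sc1 mul1r.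
rewrite [X in pos X]scK.
apply: posS; first by rewrite invr_ge0 ltW // mulr_gt0.
have -> : sc (s * t) * (sc ((s + t) * (s + t)) * inner_sq v -
    (inner_sq (X *m v) + inner_sq (Y *m v) + c)) =
  sc (s * t + t * t) * (sc (s * s) * inner_sq v - inner_sq (X *m v)) +
  sc (s * t + s * s) * (sc (t * t) * inner_sq v - inner_sq (Y *m v)) +
  (sc (t * t) * inner_sq (X *m v) + sc (s * s) * inner_sq (Y *m v) - sc (s * t) * c).
  rewrite !mulrBr !mulrA -!scM.
  rewrite (_ : s * t * ((s + t) * (s + t)) =
    (s * t + t * t) * (s * s) + (s * t + s * s) * (t * t)); last by ring.
  rewrite (scD (_ * (s * s))) (scD (s * t) (t * t)) (scD (s * t) (s * s)); ncring.
by apply: posD => //; apply: posD; apply: posS => //; rewrite addr_ge0 ?mulr_ge0 ?ltW.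
Qed.

Lemma inner_sq_sc s v : inner_sq (map_mx (fun x => sc s * x) v) = sc (s * s) * inner_sq v.
Proof.
rewrite /inner_sq big_distrr; apply: eq_bigr => i _.
by rewrite mxE starM star_sc -scC scMM.
Qed.

Lemma bounded_by_sc s : 0 <= s -> bounded_by s (sc s)%:M.
Proof.
move=> s0; split=> // v; rewrite mul_scalar_mx.
rewrite (_ : sc s *: v = map_mx (fun x => sc s * x) v) ?inner_sq_sc ?subrr; first exact: pos0.
by apply/matrixP => i j; rewrite !mxE.
Qed.

(** Expanding |(1 - X^2) v|^2 = |v|^2 - 2 |X v|^2 + |X^2 v|^2, where the last
    term is at most |X v|^2. *)
Lemma bounded_by_one_sub_sq X : mxadj X = X -> bounded_by 1 X -> bounded_by 1 (1 - X * X).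
Proof.
move=> sX b1; split=> // v; have [_ h] := b1.
have e2 : inner_sq ((1 - X * X) *m v) =
    inner_sq v - inner_sq (X *m v) - inner_sq (X *m v) + inner_sq (X *m (X *m v)).
  rewrite !inner_sqE !mxadjM mxadjB mxadjM sX.
  rewrite (_ : mxadj (1 : 'M[A]_n) = 1) ?mxadj_scalar ?star1 //.
  have mB (Y Z : 'M[A]_1) : (Y - Z) 0 0 = Y 0 0 - Z 0 0 by rewrite !mxE.
  rewrite !mulmxBl !mulmxBr !mul1mx !mulmx1 !mulmxBl.
  rewrite -[X * X]/(X *m X) !mulmxA !mB; ncring.
rewrite e2 mulr1 sc1 mul1r.
have -> : inner_sq v - (inner_sq v - inner_sq (X *m v) - inner_sq (X *m v) +
    inner_sq (X *m (X *m v))) =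
   inner_sq (X *m v) + (inner_sq (X *m v) - inner_sq (X *m (X *m v))) by ncring.
apply: posD; first exact: pos_inner_sq.
by have := h (X *m v); rewrite mulr1 sc1 mul1r.
Qed.

Lemma bounded_by_entry t X i j : bounded_by t X -> rnorm (X i j) <= t.
Proof.
move=> [t0 /(_ (delta_mx j 0))].
have -> : inner_sq (delta_mx j 0) = 1.
  rewrite /inner_sq (bigD1 j) //= mxE !eqxx star1 mul1r big1 ?addr0 // => k kj.
  by rewrite mxE (negbTE kj) mulr0.
rewrite mulr1 => h.
have : rnorm (star (X i j) * X i j) <= t * t.
  apply: norm_le; [exact: mulr_ge0|exact: pos_starM|].
  rewrite -(subrKA (inner_sq (X *m delta_mx j 0))); apply: posD => //.
  rewrite /inner_sq (bigD1 i) //= -colE mxE addrAC subrr add0r.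
  by apply: pos_sum => k _; apply: pos_starM.
rewrite rnorm_starM; have := rnorm_ge0 (X i j); nra.
Qed.

(** X is a sum of matrices with at most one nonzero entry, each bounded by the
    norm of that entry. *)
Lemma bounded_by_exists X : exists t, bounded_by t X.
Proof.
rewrite [X]matrix_sum_delta; elim/big_ind: _ => [|Y Z [s hs] [t ht]|i _].
- by exists 0; exact: bounded_by0.
- by exists (s + t); apply: bounded_byD.
elim/big_ind: _ => [|Y Z [s hs] [t ht]|j _].
- by exists 0; exact: bounded_by0.
- by exists (s + t); apply: bounded_byD.
set a := X i j; exists (rnorm a); split; first exact: rnorm_ge0.
move=> v; have -> : inner_sq (a *: delta_mx i j *m v) = star (v j 0) * (star a * a) * v j 0.
  rewrite /inner_sq (bigD1 i) //= big1 ?addr0.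
    have -> : (a *: delta_mx i j *m v) i 0 = a * v j 0.
      rewrite mxE (bigD1 j) //= big1 ?addr0 ?mxE ?eqxx ?mulr1 // => k kj.
      by rewrite !mxE (negbTE kj) andbF mulr0 mul0r.
    by rewrite starM !mulrA.
  move=> k ki; rewrite [X in _ * X]mxE big1 ?mulr0 // => l _.
  by rewrite !mxE (negbTE ki) mulr0 mul0r.
rewrite /inner_sq (bigD1 j) //= mulrDr addrAC; apply: posD.
  have -> : sc (rnorm a * rnorm a) * (star (v j 0) * v j 0) - star (v j 0) * (star a * a) * v j 0
     = star (v j 0) * (sc (rnorm a * rnorm a) - star a * a) * v j 0.
    by rewrite mulrBr mulrBl mulrA (scC _ (star (v j 0))).
  apply: pos_conj; apply: le_sc; first by rewrite starM starK.
  by rewrite rnorm_starM expr2.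
apply: posS; first by rewrite mulr_ge0 ?rnorm_ge0.
by apply: pos_sum => k _; apply: pos_starM.
Qed.
End MxBound.

(** * Roots in matrix algebras *)
Section MxRoot.
Context {R : realType} {A : cstarType R}.
Variable n : nat.
Implicit Types (s t : R) (X Y Z a w : 'M[A]_n) (v : 'cV[A]_n).

Definition mx_conv (m p : nat) (u : nat -> 'M[A]_(m, p)) (Y : 'M[A]_(m, p)) :=
  forall i j, conv (fun k => u k i j) (Y i j).

Lemma mx_convM m p q (u : nat -> 'M[A]_(m, p)) (w : nat -> 'M[A]_(p, q))
    (Y : 'M[A]_(m, p)) (Z : 'M[A]_(p, q)) :
  mx_conv u Y -> mx_conv w Z -> mx_conv (fun k => u k *m w k) (Y *m Z).
Proof.
move=> hu hw i j; rewrite mxE (_ : (fun k => _) = fun k => \sum_l u k i l * w k l j).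
  by apply: conv_sum => l; apply: convM.
by apply/funext => k; rewrite mxE.
Qed.
Lemma mx_convD m p (u w : nat -> 'M[A]_(m, p)) (Y Z : 'M[A]_(m, p)) :
  mx_conv u Y -> mx_conv w Z -> mx_conv (fun k => u k + w k) (Y + Z).
Proof.
move=> hu hw i j; rewrite mxE (_ : (fun k => _) = fun k => u k i j + w k i j).
  exact: convD.
by apply/funext => k; rewrite mxE.
Qed.
Lemma mx_conv_cst m p (Y : 'M[A]_(m, p)) : mx_conv (fun=> Y) Y.
Proof. by move=> i j; apply: conv_cst. Qed.
Lemma mx_conv_uniq m p (u : nat -> 'M[A]_(m, p)) (Y Z : 'M[A]_(m, p)) :
  mx_conv u Y -> mx_conv u Z -> Y = Z.
Proof. by move=> hy hz; apply/matrixP => i j; apply: conv_uniq (hy i j) (hz i j). Qed.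
Lemma mx_conv_adj m p (u : nat -> 'M[A]_(m, p)) (Y : 'M[A]_(m, p)) :
  mx_conv u Y -> mx_conv (fun k => mxadj (u k)) (mxadj Y).
Proof.
move=> hu i j; rewrite mxadjE (_ : (fun k => _) = fun k => star (u k j i)).
  exact: conv_star.
by apply/funext => k; rewrite mxadjE.
Qed.

Lemma mx_conv_inner_sq (u : nat -> 'cV[A]_n) v :
  mx_conv u v -> conv (fun k => inner_sq (u k)) (inner_sq v).
Proof.
by move=> hu; apply: conv_sum => i; apply: convM => //; apply: conv_star.
Qed.

Lemma bounded_by_lim t (u : nat -> 'M[A]_n) Y :
  (forall k, bounded_by t (u k)) -> mx_conv u Y -> bounded_by t Y.
Proof.
move=> hb hu; split; first exact: (hb 0%N).1.
move=> v; apply: (pos_seq_closed (u := fun k => sc (t * t) * inner_sq v - inner_sq (u k *m v))).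
  by move=> k; apply: (hb k).2.
apply: convD; first exact: conv_cst.
have h := mx_conv_inner_sq (mx_convM hu (mx_conv_cst v)).
move=> e /h[K hK]; exists K => k /hK.
by rewrite -opprD rnormN.
Qed.

Definition mx_seq_closed (S : set 'M[A]_n) := forall u Y, (forall k, S (u k)) -> mx_conv u Y -> S Y.

Lemma mulmx_scalarE Y (c : A) i j : (Y *m c%:M) i j = Y i j * c.
Proof.
rewrite mxE (bigD1 j) //= mxE eqxx big1 ?addr0 // => k kj.
by rewrite mxE (negbTE kj) mulr0.
Qed.

Lemma sc_mx_comm s Y : (sc s)%:M * Y = Y * (sc s)%:M.
Proof.
apply/matrixP => i j; rewrite -[_ * _]/(_ *m _) -[Y * _]/(_ *m _).
by rewrite mulmx_scalarE mul_scalar_mx mxE scC.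
Qed.

Lemma mx_sqrt_one_sub a : bounded_by 1 a -> exists w, [/\ bounded_by 1 w, (1 - w) * (1 - w) = 1 - a
  & forall S : set 'M[A]_n, mx_seq_closed S -> S 0 ->
    (forall u, S u -> S ((sc (2^-1))%:M * (a + u * u))) -> S w].
Proof.
move=> ba; set h : 'M[A]_n := (sc (2^-1))%:M.
have bh : bounded_by (2^-1) h by apply: bounded_by_sc; rewrite invr_ge0.
have [w hw] : exists w, mx_conv (root_iter h a) w.
  have hc i j : exists x, conv (fun k => root_iter h a k i j) x.
    apply: cauchy_conv => e /majorant_cauchy[K hK]; exists K => k m Kk km.
    have := bounded_by_entry i j (root_iter_diff (@bounded_by0 _ _ _)
      (@bounded_byD _ _ _) (@bounded_byM _ _ _) bh ba km).
    by rewrite !mxE => /le_lt_trans; apply; apply: hK.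
  exists (\matrix_(i, j) sval (cid (hc i j))) => i j; rewrite mxE.
  exact: (svalP (cid (hc i j))).
exists w; split.
- apply: bounded_by_lim hw => k.
  have [b0 hb] := root_iter_bound (@bounded_by0 _ _ _) (@bounded_byD _ _ _)
    (@bounded_byM _ _ _) bh ba k.
  split=> // v; rewrite -(subrKA (sc (majorant k * majorant k) * inner_sq v)); apply: posD => //.
  rewrite -mulrBl -scB; apply: posM; [apply: pos_sc|exact: pos_inner_sq|by rewrite scC].
  by have /andP[] := majorant_itv (R := R) k; nra.
- have e : w = h * (a + w * w).
    apply: (@mx_conv_uniq _ _ (fun k => root_iter h a k.+1)); first by move=> i j; exact: (convS (hw i j)).
    by apply: mx_convM; [exact: mx_conv_cst|apply: mx_convD; [exact: mx_conv_cst|exact: mx_convM]].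
  have : w + w = a + w * w.
    rewrite {1 2}e -mulrDl /h -raddfD /= -scD (_ : 2^-1 + 2^-1 = 1 :> R) ?sc1; last by field.
    exact: mul1mx.
  move=> e2; have -> : a = w + w - w * w by rewrite e2 addrK.
  ncring.
- move=> S cS S0 Ss; apply: cS hw => k.
  by elim: k => //= k ih; apply: Ss.
Qed.

Lemma mx_sa_sqrt_one_sub a : bounded_by 1 a -> mxadj a = a -> exists w,
  [/\ bounded_by 1 w, mxadj w = w,
  (1 - w) * (1 - w) = 1 - a, forall Y, a * Y = Y * a -> w * Y = Y * w
  & forall T, closed_alg T -> mxover T a -> mxover T w].
Proof.
move=> ba sa; have [w [bw ww hw]] := mx_sqrt_one_sub ba; exists w; split => //.
- apply: (hw [set y | mxadj y = y]) => /=.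
  + move=> u Y hu cu; apply: mx_conv_uniq (mx_conv_adj cu) _.
    by rewrite (_ : (fun k => _) = u)//; apply/funext.
  + exact: mxadj0.
  + move=> u su; rewrite -[_ * _]/(_ *m _) mxadjM mxadjD mxadjM sa su mxadj_scalar star_sc.
    exact/esym/sc_mx_comm.
- move=> Y aY; apply: (hw [set y | y * Y = Y * y]) => /=.
  + move=> u Z hu cu; apply: (@mx_conv_uniq _ _ (fun k => u k *m Y)).
      by apply: mx_convM => //; exact: mx_conv_cst.
    rewrite (_ : (fun k => _) = fun k => Y *m u k); last by apply/funext.
    by apply: mx_convM => //; exact: mx_conv_cst.
  + by rewrite mul0r mulr0.
  + move=> u uY.
    have hY : (sc 2^-1)%:M * Y = Y * (sc 2^-1)%:M by exact: sc_mx_comm.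
    rewrite -mulrA mulrDl aY -mulrA uY (mulrA u) uY -(mulrA Y) -mulrDr mulrA hY mulrA //.
move=> T cT Ta; apply: (hw (mxover T)).
- move=> u Y hu cu i j; have [cl _ _ _] := cT; apply: (cl _ _ _ (cu i j)) => k; exact: hu.
- by move=> i j; rewrite mxE; apply: closed_alg0.
- move=> u hu i j; rewrite -[_ * _]/(_ *m _) mul_scalar_mx !mxE; apply: closed_algS => //.
  apply: closed_algD => //; elim/big_ind: _ => [|x y|k _]; [exact: closed_alg0|exact: closed_algD|].
  by apply: closed_algM; rewrite ?hu.
Qed.

Lemma mxoverM T Y Z : closed_alg T -> mxover T Y -> mxover T Z -> mxover T (Y * Z).
Proof.
move=> cT hY hZ i j; rewrite mxE; elim/big_ind: _ => [|x y|k _]; [exact: closed_alg0|exact: closed_algD|].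
by apply: closed_algM; rewrite ?hY ?hZ.
Qed.
Lemma mxoverB T Y Z : closed_alg T -> mxover T Y -> mxover T Z -> mxover T (Y - Z).
Proof. by move=> cT hY hZ i j; rewrite !mxE; apply: closed_algB; [exact: cT|exact: hY|exact: hZ]. Qed.
Lemma mxover1 T : closed_alg T -> mxover T (1 : 'M[A]_n).
Proof. by move=> cT i j; rewrite mxE; case: (i == j); [exact: closed_alg1|exact: closed_alg0]. Qed.

Lemma mx_fourth_root X : mxadj X = X -> exists r, [/\ mxadj r = r, r * r * (r * r) = X * X,
  r * X = X * r & forall T, closed_alg T -> mxover T X -> mxover T r].
Proof.
move=> sX; have [t0 b0] := bounded_by_exists X.
pose t := t0 + 1; have t00 := b0.1.
have t1 : 0 < t by rewrite /t; lra.
pose S s : 'M[A]_n := (sc s)%:M.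
have SM s s' : S s * S s' = S (s * s') by rewrite /S -[_ * _]/(_ *m _) -scalar_mxM scM.
have S1 : S 1 = 1 by rewrite /S sc1.
have SS s s' Y Z : (S s * Y) * (S s' * Z) = S (s * s') * (Y * Z).
  by rewrite -SM -!mulrA; congr (_ * _); rewrite !mulrA sc_mx_comm.
have Sadj s Y : mxadj Y = Y -> mxadj (S s * Y) = S s * Y.
  move=> sY; rewrite -[S s * Y]/(_ *m _) mxadjM sY mxadj_scalar star_sc.
  by rewrite -[LHS]/(Y * S s) -sc_mx_comm.
have SO T s Y : closed_alg T -> mxover T Y -> mxover T (S s * Y).
  by move=> cT hY i j; rewrite -[S s * Y]/(_ *m _) mul_scalar_mx mxE; apply: closed_algS.
pose v := S t^-1 * X.
have sv : mxadj v = v by apply: Sadj.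
have bv : bounded_by 1 v.
  have [_ h] := b0; split=> // w; rewrite mulr1 sc1 mul1r.
  have := bounded_byM (bounded_by_sc n (ltW (_ : 0 < t^-1))) b0; rewrite invr_gt0 => /(_ t1)[_ /(_ w)].
  rewrite -/(S t^-1) -/v => h2; rewrite -(subrKA (sc (t^-1 * t0 * (t^-1 * t0)) * inner_sq w)).
  apply: posD => //; rewrite -{1}[inner_sq w]mul1r -sc1 -mulrBl -scB.
  apply: posM; [apply: pos_sc|exact: pos_inner_sq|by rewrite scC].
  have q1 : t^-1 * t0 <= 1 by rewrite ler_pdivrMl // mulr1 /t; lra.
  have q0 : 0 <= t^-1 * t0 by rewrite mulr_ge0 // invr_ge0 ltW.
  nra.
have adj1 : mxadj (1 : 'M[A]_n) = 1 by rewrite mxadj_scalar star1.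
have sa : mxadj (1 - v * v) = 1 - v * v by rewrite mxadjB -[v * v]/(v *m v) mxadjM sv adj1.
have [w [bw sw ww cw hw]] := mx_sa_sqrt_one_sub (bounded_by_one_sub_sq sv bv) sa.
have [w' [_ sw' ww' cw' hw']] := mx_sa_sqrt_one_sub bw sw.
have q : Num.sqrt t * Num.sqrt t = t by rewrite -expr2 sqr_sqrtr // ltW.
have Xv : X = S t * v by rewrite mulrA SM divff ?gt_eqF // S1 mul1r.
have hv T : closed_alg T -> mxover T X -> mxover T v by move=> cT; apply: SO.
clearbody v.
exists (S (Num.sqrt t) * (1 - w')); split.
- by apply: Sadj; rewrite mxadjB adj1 sw'.
- by rewrite !SS q ww' ww opprB addrC subrK -SS -Xv.
- have wX : w' * X = X * w'.
    apply: cw'; apply: cw; rewrite Xv.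
    have -> : (1 - v * v) * (S t * v) = S t * v - (S 1 * (v * v)) * (S t * v) by rewrite S1 mul1r mulrBl mul1r.
    have -> : S t * v * (1 - v * v) = S t * v - (S t * v) * (S 1 * (v * v)) by rewrite S1 mul1r mulrBr mulr1.
    by congr (_ - _); rewrite !SS (mulrC t) (mulrA v v v).
  rewrite -mulrA mulrBl mul1r wX /S (mulrA X) -sc_mx_comm -(mulrA _ X); congr (_ * _).
  by rewrite mulrBr mulr1.
- move=> T cT hX; apply: (SO) => //; apply: mxoverB => //; first exact: mxover1.
  apply: hw' => //; apply: hw => //; apply: mxoverB => //; first exact: mxover1.
  by apply: mxoverM => //; apply: hv.
Qed.
End MxRoot.

(** * Positivity detected by a faithful compression *)
Section Faithful.
Context {R : realType} {A : cstarType R}.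
Variable n : nat.
Implicit Types (X Y Z W : 'M[A]_n).

Lemma mx_star_add_eq0 X Y : mxadj X *m X + mxadj Y *m Y = 0 -> Y = 0.
Proof.
move=> h; apply/matrixP => i j; rewrite mxE; apply: starM_eq0.
have /matrixP/(_ j j) := h; rewrite !mxE addrC => e.
have hp Z : pos (\sum_k mxadj Z j k * Z k j).
  by apply: pos_sum => k _; rewrite mxadjE; apply: pos_starM.
have := pos_add_eq0 (hp Y) (hp X) e.
move/pos_sum_eq0 => h2; have := h2 _ i; rewrite mxadjE; apply.
by move=> k; rewrite mxadjE; apply: pos_starM.
Qed.

Lemma mx_star_eq0 Y : mxadj Y *m Y = 0 -> Y = 0.
Proof. by move=> h; apply: (mx_star_add_eq0 (X := 0)); rewrite mulmx0 add0r. Qed.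

(** Let m be the absolute value of d and N = m - d.  The compressed matrix
    S d S, with S the scalar matrix of s, is positive, while
    N S d S N = - (r N S)^* (r N S), where r^2 = m.  So r N S = 0, and
    faithfulness of s on the entries gives r N = 0, then N = 0 and
    d = m = r^* r. *)
Lemma positive_of_faithful_compression (D : set A) (s : A) (d W : 'M[A]_n) :
  cstar_subalgebra D -> star s = s -> (forall x, D x -> x * s = s * x) ->
  (forall x, D x -> x * s = 0 -> x = 0) ->
  mxover D d -> s%:M *m d *m s%:M = mxadj W *m W ->
  exists2 V, mxover D V & d = mxadj V *m V.
Proof.
move=> sD ss cs fs Dd eW.
have cD := closed_alg_subalgebra sD; have [_ _ _ Dstar _] := sD.
have eS X i j : (s%:M *m X *m s%:M) i j = s * X i j * s.
  by rewrite mulmx_scalarE mul_scalar_mx mxE.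
have sd : mxadj d = d.
  have e : mxadj (s%:M *m d *m s%:M) = s%:M *m d *m s%:M by rewrite eW mxadjM mxadjK.
  apply/matrixP => i j; rewrite mxadjE; apply/eqP; rewrite -subr_eq0; apply/eqP.
  have /matrixP/(_ i j) := e; rewrite mxadjE !eS !starM ss mulrA => e2.
  set x := _ - _; have Dx : D x by apply: (closed_algB cD); [apply: Dstar; exact: Dd|exact: Dd].
  apply: fs => //.
  have h : x * s * s = 0.
    by rewrite (cs _ Dx) mulrBr mulrBl e2 subrr.
  rewrite -[x * s]starK; rewrite (_ : star (x * s) = 0) ?star0 //.
  by apply: starM_eq0; rewrite starK starM ss mulrA h mul0r.
have [r [sr rd cr hr]] := mx_fourth_root sd.
have Dr := hr _ cD Dd.
pose m : 'M[A]_n := r * r; pose N : 'M[A]_n := m - d; pose S : 'M[A]_n := s%:M.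
have md : m * d = d * m by rewrite /m -mulrA cr mulrA cr mulrA.
have NN : N * N = (m + m) * N by apply: gap_sqr.
have DN : mxover D N by apply: mxoverB => //; apply: mxoverM.
have adjM (X Y : 'M[A]_n) : mxadj (X * Y) = mxadj Y * mxadj X by exact: mxadjM.
have sN : mxadj N = N by rewrite /N mxadjB adjM sr sd.
have rN : r * N = N * r by rewrite /N mulrBr mulrBl cr mulrA.
have dN : d * N = - (m * N) by rewrite /N !mulrBr opprB -md -/m rd.
have SN : S * N = N * S.
  apply/matrixP => i j; rewrite -[S * N]/(_ *m _) -[N * S]/(_ *m _).
  by rewrite mulmx_scalarE mul_scalar_mx mxE cs.
have sS : mxadj S = S by rewrite mxadj_scalar ss.
have eW' : S * d * S = mxadj W * W by exact: eW.
have rNS : r * N * S = 0.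
  apply: (@mx_star_add_eq0 (W * N)).
  rewrite -[_ *m (W * N)]/(_ * _) -[_ *m (r * N * S)]/(_ * _) !adjM sN sr sS.
  have -> : N * mxadj W * (W * N) = - (S * (N * r) * (r * N * S)).
    have -> : N * mxadj W * (W * N) = N * (S * d * S) * N by rewrite eW' !mulrA.
    have -> : N * (S * d * S) * N = S * (N * (d * N)) * S.
      by rewrite !mulrA -SN -(mulrA _ S N) {2}SN !mulrA.
    by rewrite dN !mulrN mulNr /m !mulrA.
  by rewrite !mulrA addNr.
have rN0 : r * N = 0.
  have Dr' := mxoverM cD Dr DN.
  apply/matrixP => i j; rewrite [RHS]mxE; apply: fs; first exact: Dr'.
  by have /matrixP/(_ i j) := rNS; rewrite -[_ * S]/(_ *m _) mulmx_scalarE [RHS]mxE.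
have N0 : N = 0.
  apply: mx_star_eq0; rewrite -[LHS]/(_ * _) sN NN mulrDl /m -mulrA rN0 mulr0 addr0 //.
exists r => //; rewrite sr; apply/esym/eqP; rewrite -subr_eq0; apply/eqP.
exact: N0.
Qed.
End Faithful.

(** * Pseudo-expectations killing a given element *)
Section Kill.
Context {R : realType} {A I : cstarType R}.
Variables (D : set A) (iota : A -> I).
Hypotheses (sD : cstar_subalgebra D) (embD : unital_star_embedding D iota)
  (injI : injective_system [set: I]).
Variables (s k : A).
Hypotheses (ss : star s = s) (cs : forall x, D x -> x * s = s * x)
  (fs : forall x, D x -> x * s = 0 -> x = 0) (sk : star k = k) (ks : k * s = 0).

Let E : set A := [set x | exists2 d, D d & exists t : R[i], x = d + t *: k].
Let f (x : A) : I :=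
  iota (xget 0 [set d | D d /\ exists t : R[i], x = d + t *: k]).

Let skZ (t : R[i]) : t *: k * s = 0.
Proof. by rewrite -[LHS]/(cstar_mul (t *: k) s) -cstar_scaleAl -[cstar_mul k s]/(k * s) ks scaler0. Qed.

Let fE d (t : R[i]) : D d -> f (d + t *: k) = iota d.
Proof.
move=> Dd; rewrite /f; congr iota; case: xgetP => [d' _ [Dd' [t' e]]|/(_ d) h]; last first.
  by exfalso; apply: h; split => //; exists t.
have cD := closed_alg_subalgebra sD.
apply/eqP; rewrite -subr_eq0; apply/eqP; apply: fs; first exact: closed_algB.
have : (d + t *: k) * s = (d' + t' *: k) * s by rewrite e.
by rewrite mulrBl !mulrDl !skZ !addr0 => ->; rewrite subrr.
Qed.

Let fD d : D d -> f d = iota d.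
Proof. by move=> Dd; rewrite -{1}[d]addr0 -[0](scale0r k) fE. Qed.

(** The decomposition of an element of D + C k is unique on its D-component,
    because the component survives multiplication by s.  Hence d + t k |-> iota d
    is well defined; it is completely positive because a positive Y over D + C k
    satisfies s Y s = s d s, with d its D-component. *)
Lemma pseudo_expectation_killing : exists2 Psi, pseudo_expectation D iota Psi & Psi k = 0.
Proof.
have cD := closed_alg_subalgebra sD; have [D1 DD DM Dstar _] := sD.
have [[_ i1 iD] iM istar _] := embD.
have D0 := closed_alg0 cD.
have ED d : D d -> E d by move=> Dd; exists d => //; exists 0; rewrite scale0r addr0.
have Ek : E k by exists 0 => //; exists 1; rewrite scale1r add0r.
have ELin (a : R[i]) x y : E x -> E y -> E (a *: x + y).
  move=> [d Dd [t ->]] [d' Dd' [t' ->]]; exists (a *: d + d'); first exact: DD.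
  by exists (a * t + t'); rewrite scalerDr scalerDl scalerA addrACA.
have osE : operator_system E.
  split => //; first exact: ED.
  move=> x [d Dd [t ->]]; exists (star d); first exact: Dstar.
  by exists t^*; rewrite starD starZ sk.
have osM : operator_system [set: A] by [].
have i0 : iota 0 = 0.
  have := iD (-1) _ _ D1 D1; rewrite !scaleN1r !addNr; exact.
have ucpf : ucp E [set: I] f.
  split; first split => //.
  - by rewrite fD.
  - move=> a x y [d Dd [t ->]] [d' Dd' [t' ->]].
    rewrite !fE // scalerDr scalerA addrACA -scalerDl fE ?iD //; exact: DD.
  move=> n Y EY [Z eZ].
  pose d : 'M[A]_n := \matrix_(i, j) xget 0 [set d | D d /\ exists t : R[i], Y i j = d + t *: k].
  have dP i j : D (d i j) /\ exists t : R[i], Y i j = d i j + t *: k.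
    rewrite mxE; case: xgetP => // h; have [x Dx [t e]] := EY i j.
    by exfalso; apply: (h x); split => //; exists t.
  have Dd : mxover D d by move=> i j; case: (dP i j).
  have sks (t : R[i]) : s * (t *: k) * s = 0 by rewrite -mulrA skZ mulr0.
  have e : s%:M *m d *m s%:M = mxadj (Z *m s%:M) *m (Z *m s%:M).
    rewrite mxadjM mxadj_scalar ss !mulmxA -(mulmxA _ (mxadj Z)) -eZ.
    apply/matrixP => i j; rewrite !mulmx_scalarE !mul_scalar_mx.
    rewrite [X in X * _ = _]mxE [in RHS]mxE; have [_ [t ->]] := dP i j.
    by rewrite mulrDr mulrDl sks addr0.
  have [V DV dV] := positive_of_faithful_compression sD ss cs fs Dd e.
  exists (map_mx iota V); apply/matrixP => i j.
  have -> : map_mx f Y i j = iota (d i j) by rewrite mxE /d [in RHS]mxE.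
  rewrite dV !mxE.
  have isum (J : Type) (r : seq J) (F : J -> A) : (forall x, D (F x)) ->
      iota (\sum_(x <- r) F x) = \sum_(x <- r) iota (F x) /\ D (\sum_(x <- r) F x).
    move=> hF; elim: r => [|x r [ih1 ih2]]; first by rewrite !big_nil.
    rewrite !big_cons -ih1; split; last exact: closed_algD.
    by have := iD 1 _ _ (hF x) ih2; rewrite !scale1r.
  have h2 l : D (mxadj V i l * V l j).
    by apply: DM; [rewrite mxadjE; apply: Dstar|]; exact: DV.
  have [-> _] := isum _ (index_enum 'I_n) _ h2.
  apply: eq_bigr => l _; rewrite !mxadjE !mxE iM ?istar //; try exact: DV.
  by apply: Dstar; exact: DV.
have [g [ucpg gf]] := injI.2 A E [set: A] osE osM (@subsetT _ _) f ucpf.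
exists g; last first.
  rewrite gf // -[k]add0r -[X in 0 + X]scale1r fE //.
by split=> // d Dd; rewrite gf ?fD //; apply: ED.
Qed.
End Kill.

(** * Weak-star limits along ultrafilters *)
Section UltraLimit.
Context {R : realType} {T : Type} (F : set_system T) {FF : UltraFilter F}.

Lemma ultra_real_limit (g : T -> R) b : (forall c, `|g c| <= b) ->
  exists a, forall e, 0 < e -> F [set c | `|g c - a| < e].
Proof.
move=> hb; pose S := [set t | F [set c | t <= g c]].
have hS : has_sup S.
  split.
    exists (- b); rewrite /S /=; apply: (filterS _ filterT) => c _ /=.
    by have := hb c; rewrite ler_norml => /andP[].
  exists b => t /filter_ex[c /= tc]; apply: le_trans tc _.
  by have := hb c; rewrite ler_norml => /andP[].
exists (sup S) => e e0.
have [t St ht] := sup_adherent e0 hS.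
have F2 : F (~` [set c | sup S + e / 2 <= g c]).
  have [h|//] := in_ultra_setVsetC [set c | sup S + e / 2 <= g c] FF.
  have := ub_le_sup hS.2 h; lra.
apply: filterS (filterI St F2) => c /= [h1 /negP]; rewrite -ltNge => h2.
by rewrite ltr_norml; apply/andP; split; lra.
Qed.

Lemma ultra_complex_limit (g : T -> R[i]^o) b : (forall c, rnorm (g c) <= b) ->
  exists z : R[i]^o, forall e, 0 < e -> F [set c | rnorm (g c - z) < e].
Proof.
move=> hb.
have nRe (z : R[i]^o) : `|complex.Re z| <= rnorm z.
  by rewrite -lecR -norm_rnorm; exact: normc_ge_Re.
have nIm (z : R[i]^o) : `|complex.Im z| <= rnorm z.
  rewrite /rnorm normc_def /= -sqrtr_sqr ler_wsqrtr // lerDr sqr_ge0 //.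
have [x hx] := ultra_real_limit (g := fun c => complex.Re (g c)) (fun c => le_trans (nRe _) (hb c)).
have [y hy] := ultra_real_limit (g := fun c => complex.Im (g c)) (fun c => le_trans (nIm _) (hb c)).
exists (x +i* y) => e e0; have e2 : 0 < e / 2 by lra.
apply: filterS (filterI (hx _ e2) (hy _ e2)) => c /= [].
case: (g c) => u v /= h1 h2.
have -> : ((u +i* v : R[i]^o) - (x +i* y)) = (u - x)%:C + (v - y)%:C * 'i.
  by apply/eqP; rewrite eq_complex /=; apply/andP; split; apply/eqP; ring.
apply: le_lt_trans (rnormD (V := R[i]^o) _ _) _.
rewrite {1}/rnorm normCR [X in _ + X](_ : _ = `|v - y|); first by lra.
by rewrite -[_ * 'i]/((v - y)%:C *: ('i : R[i]^o)) rnormZ normCR /rnorm normCi mulr1.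
Qed.

End UltraLimit.

Section Predual.
Context {R : realType} {A : cstarType R} {X : completeNormedModType R[i]}.
Variable (pairing : A -> X -> R[i]^o).
Hypothesis hp : is_predual pairing.

Lemma pairingB m m' x : pairing (m - m') x = pairing m x - pairing m' x.
Proof.
have [h _ _ _] := hp; have := h (-1) m' m x.
by rewrite scaleN1r addrC mulN1r [in RHS]addrC.
Qed.

Lemma pairing_has_sup m :
  has_sup [set rnorm (pairing m x) | x in [set x : X | rnorm x <= 1]].
Proof.
split; first by exists (rnorm (pairing m 0)); exists 0; rewrite //= rnorm0 ler01.
have [_ /(_ m)[lin cts] _ _] := hp.
have p0 : pairing m 0 = 0.
  by have := lin (-1) 0 0; rewrite !scaleN1r oppr0 addr0 addNr.
have /cvgrPdist_lt/(_ 1 ltr01) := cts 0.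
rewrite p0 => /nbhs_ballP[e /complex_gt0P[d d0 ->]] /= hd.
exists (2 / d) => _ [x /= x1 <-].
have dC : (d / 2)%:C *: x \in [set: X] by rewrite in_setT.
have : rnorm (pairing m ((d / 2)%:C *: x)) < 1.
  rewrite -rnormN -[- _]add0r -ltcR -norm_rnorm; apply: hd.
  rewrite -ball_normE /ball_ /= sub0r normrN norm_rnorm ltcR rnormZ normCR ger0_norm; last by lra.
  by have := rnorm_ge0 x; nra.
have -> : pairing m ((d / 2)%:C *: x) = (d / 2)%:C *: pairing m x.
  by have := lin (d / 2)%:C x 0; rewrite p0 !addr0.
rewrite rnormZ normCR ger0_norm; last by lra.
move=> h; rewrite ler_pdivlMr //; nra.
Qed.

Lemma pairing_le1 m x : rnorm x <= 1 -> rnorm (pairing m x) <= rnorm m.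
Proof.
move=> x1; have [_ _ -> _] := hp; apply: ub_le_sup; first exact: (pairing_has_sup m).2.
by exists x.
Qed.

Lemma pairing_le m x : rnorm (pairing m x) <= rnorm m * rnorm x.
Proof.
have [_ /(_ m)[lin cts] _ _] := hp.
have p0 : pairing m 0 = 0.
  by have := lin (-1) 0 0; rewrite !scaleN1r oppr0 addr0 addNr.
have [/rnorm_eq0 ->|x0] := eqVneq (rnorm x) 0; first by rewrite p0 !rnorm0 mulr0.
have x1 : 0 < rnorm x by rewrite lt_def x0 rnorm_ge0.
have h : rnorm ((rnorm x)^-1%:C *: x) <= 1.
  by rewrite rnormZ normCR ger0_norm ?invr_ge0 ?rnorm_ge0 // mulVf ?lexx.
have := pairing_le1 m h.
have -> : pairing m ((rnorm x)^-1%:C *: x) = (rnorm x)^-1%:C *: pairing m x.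
  by have := lin (rnorm x)^-1%:C x 0; rewrite p0 !addr0.
by rewrite rnormZ normCR ger0_norm ?invr_ge0 ?rnorm_ge0 // ler_pdivrMl // mulrC.
Qed.

Lemma norm_le_pairing m r : (forall x, rnorm x <= 1 -> rnorm (pairing m x) <= r) -> rnorm m <= r.
Proof.
move=> h; have [_ _ -> _] := hp; apply: ge_sup; first exact: (pairing_has_sup m).1.
by move=> _ [x x1 <-]; apply: h.
Qed.

(** Alaoglu's theorem along one ultrafilter.  The pointwise limit of the
    functionals is bounded, hence represented by some m; weak-star closedness
    of D puts m in D, and closed balls are preserved because the norm is a
    supremum of pairings. *)
Lemma weak_star_limit (D : set A) (F : set_system A) (FF : UltraFilter F) b :
  sigma_closed pairing D -> F [set c | D c /\ rnorm c <= b] ->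
  exists2 m, D m & forall a r, F [set c | rnorm (c - a) <= r] -> rnorm (m - a) <= r.
Proof.
move=> cD FD.
have b0 : 0 <= b by have [c [_ /= h]] := filter_ex FD; apply: le_trans h; apply: rnorm_ge0.
(* Truncated so as to be bounded for every c, not only along F. *)
pose g c x : R[i]^o := if rnorm c <= b then pairing c x else 0.
have Fg c : rnorm c <= b -> g c = pairing c.
  by move=> h; apply/funext => x; rewrite /g h.
have gb x c : rnorm (g c x) <= b * rnorm x.
  rewrite /g; case: ifPn => h; last by rewrite rnorm0 mulr_ge0 // rnorm_ge0.
  by apply: le_trans (pairing_le _ _) _; rewrite ler_wpM2r // rnorm_ge0.
have lim x : exists z : R[i]^o, forall e, 0 < e -> F [set c | rnorm (g c x - z) < e].
  exact: ultra_complex_limit (gb x).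
pose phi x := sval (cid (lim x)).
have hphi x e : 0 < e -> F [set c | rnorm (pairing c x - phi x) < e].
  move=> e0; have := svalP (cid (lim x)) e e0; rewrite -/(phi x) => h.
  by apply: filterS (filterI h FD) => c /= [+ [_ cb]]; rewrite Fg.
have philin : linear phi.
  move=> a x y; apply/eqP; rewrite -subr_eq0; apply/eqP; apply: rnorm_eq0.
  apply/eqP; rewrite eq_le rnorm_ge0 andbT; apply/ler_addgt0Pl => e e0; rewrite addr0.
  set na := complex.Re `|a|; have na0 : 0 <= na.
    by have := rnorm_ge0 (a : R[i]^o); rewrite /rnorm.
  pose d := e / (na + 2); have d0 : 0 < d by rewrite divr_gt0 //; lra.
  have de : d * (na + 2) = e by rewrite divfK // gt_eqF //; lra.
  have [c [[/= h1 h2] h3]] := filter_ex (filterI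
    (filterI (hphi x _ d0) (hphi y _ d0)) (hphi (a *: x + y) _ d0)).
  have [_ /(_ c)[lin _] _ _] := hp.
  have -> : phi (a *: x + y) - (a *: phi x + phi y) =
     (phi (a *: x + y) - pairing c (a *: x + y)) + (a *: (pairing c x - phi x) + (pairing c y - phi y)).
    by rewrite lin scalerBr [a *: _ - _ + _]addrACA -opprD addrA subrK.
  apply: le_trans (rnormD _ _) _; rewrite rdistC.
  have := rnormD (a *: (pairing c x - phi x)) (pairing c y - phi y).
  rewrite rnormZ -/na.
  have : na * rnorm (pairing c x - phi x) <= na * d by rewrite ler_wpM2l // ltW.
  by rewrite /= in h3; lra.
have phile x : rnorm (phi x) <= b * rnorm x.
  apply/ler_addgt0Pl => e e0.
  have [c [/= h1 [_ /= cb]]] := filter_ex (filterI (hphi x _ e0) FD).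
  have := pairing_le c x; have := rnormB (pairing c x) (pairing c x - phi x).
  rewrite opprB addrC subrK.
  have : rnorm c * rnorm x <= b * rnorm x by rewrite ler_wpM2r // rnorm_ge0.
  lra.
have phicts : continuous phi.
  move=> x; apply/cvgrPdist_lt => _ /complex_gt0P[e e0 ->].
  have d0 : 0 < e / (b + 1) by rewrite divr_gt0 //; lra.
  apply/nbhs_ballP; exists (e / (b + 1))%:C => /=; first by rewrite ltcR.
  move=> y; rewrite -ball_normE /ball_ /= !norm_rnorm !ltcR ltr_pdivlMr; last by lra.
  have -> : phi x - phi y = phi (x - y).
    by have h := philin (-1) y x; rewrite !scaleN1r in h; rewrite addrC -h; congr phi; rewrite addrC.
  have := phile (x - y); have := rnorm_ge0 (x - y); nra.
have [_ _ _ /(_ phi philin phicts)[m em]] := hp.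
exists m.
  apply: contrapT => nD.
  have : @open (@initial_topology A {ptws X -> R[i]^o} pairing) (~` D) by exact: closed_openC.
  move=> [B oB eB].
  have Bphi : B phi.
    have : (pairing @^-1` B) m by rewrite eB; exact: nD.
    by rewrite /preimage /= em.
  have : {ptws, (pairing @ F) --> phi}.
    apply/pointwise_cvgP => x; apply/cvgrPdist_lt => _ /complex_gt0P[e e0 ->].
    suff : F [set c | `|phi x - pairing c x| < e%:C] by [].
    by apply: filterS (hphi x _ e0) => c /= h; rewrite norm_rnorm ltcR rdistC.
  move=> /(_ B); rewrite /= nbhs_filterE => h.
  have FB : F (pairing @^-1` B) by apply: h; apply: open_nbhs_nbhs; split.
  by have [c [/= h1 [h2 _]]] := filter_ex (filterI FB FD); have : (pairing @^-1` B) c := h1; rewrite eB.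
move=> a r Fr; apply: norm_le_pairing => x x1.
rewrite pairingB em; apply/ler_addgt0Pl => e e0.
have [c [/= h1 h2]] := filter_ex (filterI (hphi x _ e0) Fr).
rewrite -(subrKA (pairing c x)); apply: le_trans (rnormD _ _) _.
rewrite rdistC -pairingB; have := pairing_le1 (c - a) x1; lra.
Qed.
End Predual.

(** * Annihilators in a weak-star closed subalgebra *)
Section Decay.
Context {R : realType} {A : cstarType R}.
Implicit Types (f g x w c l p d : A).

Lemma sc_half_half : sc (2^-1) + sc (2^-1) = 1 :> A.
Proof. by rewrite -scD (_ : 2^-1 + 2^-1 = 1 :> R) ?sc1 //; field. Qed.

(** Order intervals of length 1 are the self-adjoint parts of balls of radius
    1/2; this is how order relations pass to weak-star limits. *)
Lemma unit_interval_ball w : pos w -> pos (1 - w) -> rnorm (w - sc (2^-1)) <= 2^-1.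
Proof.
move=> pw pw1; apply: order_norm; first by rewrite invr_ge0.
  by rewrite opprB addrCA addrA sc_half_half.
by rewrite addrC subrK.
Qed.

Lemma ball_unit_interval w : star w = w -> rnorm (w - sc (2^-1)) <= 2^-1 ->
  pos w /\ pos (1 - w).
Proof.
move=> sw hw; have h2 : star (w - sc (2^-1)) = w - sc (2^-1) by rewrite starB sw star_sc.
split.
  have -> : w = sc (2^-1) - (sc (2^-1) - w) by rewrite opprB addrC subrK.
  by apply: le_sc; [rewrite -opprB starN h2|rewrite rdistC].
have -> : 1 - w = sc (2^-1) - (w - sc (2^-1)) by rewrite opprB addrA sc_half_half.
exact: le_sc.
Qed.

Section Powers.
Variable f : A.
Hypotheses (pf : pos f) (pf1 : pos (1 - f)).
Let g := 1 - f.

Let cfg : f * g = g * f.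
Proof. by rewrite /g mulrBr mulrBl mulr1 mul1r. Qed.
Let cfgn n : f * g ^+ n = g ^+ n * f.
Proof. exact: commrX. Qed.

Lemma pos_pow n : pos (g ^+ n).
Proof.
elim: n => [|n ih]; first by rewrite expr0 -sc1; apply: pos_sc.
by rewrite exprS; apply: posM => //; rewrite -exprS exprSr.
Qed.

Let pos_fgn n : pos (f * g ^+ n).
Proof. apply: posM => //; exact: pos_pow. Qed.

(** 1 - g^n = f (1 + g + ... + g^(n-1)), and each of the n terms is at least
    f g^n. *)
Lemma pos_pow_bernoulli n : pos (1 - g ^+ n - sc n%:R * (f * g ^+ n)).
Proof.
elim: n => [|n ih]; first by rewrite sc0 mul0r subr0 expr0 subrr; apply: pos0.
have -> : 1 - g ^+ n.+1 - sc n.+1%:R * (f * g ^+ n.+1) =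
   (1 - g ^+ n - sc n%:R * (f * g ^+ n)) + sc (n.+1%:R) * (f * (f * g ^+ n)).
  have e : g ^+ n.+1 = g ^+ n - f * g ^+ n by rewrite exprS {1}/g mulrBl mul1r.
  by rewrite e -natr1 scD sc1; ncring.
apply: posD => //; apply: posS => //; apply: posM => //.
by rewrite -mulrA -cfgn.
Qed.

Lemma pos_one_sub_pow n : pos (1 - g ^+ n).
Proof.
rewrite -[X in pos X](subrK (sc n%:R * (f * g ^+ n))); apply: posD.
  exact: pos_pow_bernoulli.
exact: posS.
Qed.

Lemma pow_decay n : n%:R * rnorm (f * g ^+ n) <= 1.
Proof.
rewrite -[X in X * _](ger0_norm (ler0n R n)) -rnorm_scM.
apply: norm_le => //; first exact: posS.
rewrite sc1 -[X in pos X](subrK (g ^+ n)); apply: posD; last exact: pos_pow.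
by rewrite addrAC; exact: pos_pow_bernoulli.
Qed.

(** Together with the next lemma: for a positive contraction c, the relation
    c f = 0 amounts to c <= (1 - f)^n for all n, a condition made of order
    intervals and therefore stable under weak-star limits. *)
Lemma below_pow_annihilates c : pos c -> (forall n, pos (g ^+ n - c)) -> c * f = 0.
Proof.
move=> pc hc.
have f1 : rnorm f <= 1 by apply: norm_le => //; rewrite sc1.
have sf := pos_sa pf.
have key n : n%:R * rnorm (f * c * f) <= 1.
  apply: le_trans (pow_decay n); rewrite ler_wpM2l //.
  have h1 : rnorm (f * c * f) <= rnorm (f * g ^+ n * f).
    apply: norm_mono; first by rewrite -{1}sf; apply: pos_conj.
    by rewrite -mulrBl -mulrBr -{1}sf; apply: pos_conj.
  apply: le_trans h1 _; apply: le_trans (rnormM _ _) _.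
  by rewrite ler_piMr ?rnorm_ge0.
have h0 : f * c * f = 0.
  apply: rnorm_eq0; apply/eqP; rewrite eq_le rnorm_ge0 andbT leNgt; apply/negP => h.
  have := key (Num.bound (rnorm (f * c * f))^-1).
  have := archi_boundP (x := (rnorm (f * c * f))^-1).
  rewrite invr_ge0 rnorm_ge0 => /(_ isT); rewrite -(ltr_pM2r h) mulVf ?gt_eqF //.
  by move=> h2 /(lt_le_trans h2); rewrite ltxx.
have [u [su uu _]] := pos_sqrt pc.
have : u * f = 0.
  by apply: starM_eq0; rewrite starM su sf -mulrA (mulrA u) uu mulrA.
by rewrite -uu -mulrA => ->; rewrite mulr0.
Qed.

Lemma annihilates_below_pow c : pos c -> pos (1 - c) -> c * f = 0 -> forall n, pos (g ^+ n - c).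
Proof.
move=> pc pc1 cf n.
have fc : f * c = 0 by rewrite -(pos_sa pf) -(pos_sa pc) -starM cf star0.
have cg : c * g ^+ n = c.
  by elim: n => [|n ih]; rewrite ?expr0 ?mulr1 // exprSr mulrA ih /g mulrBr cf mulr1 subr0.
have gc : g ^+ n * c = c.
  by elim: n {cg} => [|n ih]; rewrite ?expr0 ?mul1r // exprS -mulrA ih /g mulrBl fc mul1r subr0.
have -> : g ^+ n - c = g ^+ n * (1 - c) by rewrite mulrBr mulr1 gc.
apply: posM => //; first exact: pos_pow.
by rewrite mulrBr mulrBl mulr1 mul1r gc cg.
Qed.
End Powers.
End Decay.

Section Annihilator.
Context {R : realType} {A : cstarType R} {X : completeNormedModType R[i]}.
Variables (pairing : A -> X -> R[i]^o) (D : set A).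
Hypotheses (hp : is_predual pairing) (sD : cstar_subalgebra D) (cD : sigma_closed pairing D).

Section Contraction.
Variable f : A.
Hypotheses (pf : pos f) (pf1 : pos (1 - f)).

Let S : set A := [set c | [/\ D c, pos c, pos (1 - c) & c * f = 0]].

(** An ultrafilter containing the tails of C has a weak-star limit; its real part
    is an upper bound. *)
Lemma chain_bound (C : set A) : C !=set0 -> C `<=` S ->
  (forall c c', C c -> C c' -> pos (c' - c) \/ pos (c - c')) ->
  exists2 a, S a & forall c, C c -> pos (a - c).
Proof.
move=> [c0 Cc0] CS tot.
have aD := closed_alg_subalgebra sD; have [_ _ _ Dstar _] := sD.
pose tail c : set A := [set c' | C c' /\ pos (c' - c)].
have PF : ProperFilter (filter_from C tail).
  apply: filter_from_proper; last first.
    by move=> c Cc; exists c; split => //; rewrite subrr; apply: pos0.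
  apply: filter_from_filter; first by exists c0.
  move=> c c' Cc Cc'; have [h|h] := tot _ _ Cc Cc'.
    exists c' => // x [Cx px]; split; split => //.
    by rewrite -(subrKA c'); apply: posD.
  exists c => // x [Cx px]; split; split => //.
  by rewrite -(subrKA c); apply: posD.
have [F [UF sF]] := ultraFilterLemma PF.
have FC c : C c -> F (tail c) by move=> Cc; apply: sF; exists c.
have FD : F [set c | D c /\ rnorm c <= 1].
  apply: filterS (FC _ Cc0) => c [/CS[Dc pc pc1 _] _]; split => //.
  by apply: norm_le; rewrite ?sc1.
have [m Dm hm] := weak_star_limit hp UF cD FD.
pose a := sc (2^-1) * (m + star m).
have sa : star a = a by rewrite /a starM star_sc scC starD starK (addrC (star m)).
have Da : D a by apply: closed_algS => //; apply: closed_algD => //; apply: Dstar.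
have ball g (r : R) : star g = g -> rnorm (m - g) <= r -> rnorm (a - g) <= r.
  move=> sg h.
  have -> : a - g = sc (2^-1) * ((m - g) + star (m - g)).
    rewrite starB sg addrACA -opprD [RHS]mulrBr; congr (_ - _).
    by rewrite mulrDr -mulrDl sc_half_half mul1r.
  rewrite rnorm_scM ger0_norm ?invr_ge0 //.
  by have := rnormD (m - g) (star (m - g)); rewrite rnorm_star; lra.
have interval g : star g = g -> F [set c | pos (c - g) /\ pos (1 - (c - g))] ->
    pos (a - g) /\ pos (1 - (a - g)).
  move=> sg Fg; apply: ball_unit_interval; first by rewrite starB sa sg.
  rewrite -addrA -opprD; apply: ball; first by rewrite starD sg star_sc.
  apply: hm; apply: filterS Fg => c /= [p1 p2].
  by rewrite opprD addrA; apply: unit_interval_ball.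
have FS : F S by apply: filterS (FC _ Cc0) => c [/CS].
have [pa pa1] : pos a /\ pos (1 - a).
  have := interval 0 star0; rewrite !subr0; apply.
  by apply: filterS FS => c [_ p1 p2 _] /=; rewrite subr0.
exists a.
  split => //; apply: (below_pow_annihilates pf pf1) => // n.
  have pg := pos_pow pf1 n; have pg1 := pos_one_sub_pow pf pf1 n.
  set g := (1 - f) ^+ n in pg pg1 *.
  (* Members of S lie between g - 1 and g, an interval of length 1. *)
  have [_] : pos (a - (g - 1)) /\ pos (1 - (a - (g - 1))).
    apply: interval; first by rewrite starB (pos_sa pg) star1.
    apply: filterS FS => c [_ pc pc1 cf] /=; split.
      have -> : c - (g - 1) = (1 - g) + c by ncring.
      exact: posD.
    have -> : 1 - (c - (g - 1)) = g - c by ncring.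
    exact: annihilates_below_pow.
  by have -> : 1 - (a - (g - 1)) = g - a by ncring.
move=> c Cc; have [Dc pc pc1 cf] := CS _ Cc.
have h : F [set c' | pos (c' - c) /\ pos (1 - (c' - c))].
  apply: filterS (FC _ Cc) => c' [/CS[_ p1 p2 _] p3]; split => //.
  have -> : 1 - (c' - c) = (1 - c') + c by ncring.
  exact: posD.
by have [] := interval c (pos_sa pc) h.
Qed.

(** A maximal element p of S, which exists by Zorn's lemma, is a right unit of
    the annihilator: for a contraction l in it, p + (1 - p) l^* l (1 - p) is
    again in S, so (1 - p) l^* l (1 - p) = 0 and l = l p. *)
Lemma contraction_annihilator : exists p, [/\ D p, pos p, p * f = 0
  & forall l, D l -> l * f = 0 -> l * p = l].
Proof.
have aD := closed_alg_subalgebra sD; have [_ _ _ Dstar _] := sD.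
have p1 : pos (1 : A) by rewrite -sc1; apply: pos_sc.
pose T := {c : A | S c}.
pose le (c c' : T) := `[< pos (sval c' - sval c) >].
have S0 : S 0 by split; [exact: closed_alg0|exact: pos0|rewrite subr0|rewrite mul0r].
have [||||[p [Dp pp pp1 pf0]] hmax] := @Zorn T le.
- by move=> c; apply/asboolP; rewrite subrr; apply: pos0.
- by move=> a b c /asboolP h1 /asboolP h2; apply/asboolP; rewrite -(subrKA (sval b)); apply: posD.
- move=> [a Sa] [b Sb] /asboolP /= h1 /asboolP /= h2.
  have e : a = b.
    by apply/eqP; rewrite -subr_eq0; apply/eqP; apply: pos_anti => //; rewrite opprB.
  by move: Sa Sb; rewrite e => Sa Sb; congr exist; apply: Prop_irrelevance.
- move=> C tot; have [->|/set0P[c Cc]] := eqVneq C set0.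
    by exists (exist _ 0 S0).
  have [|||a Sa ha] := @chain_bound (sval @` C).
  + by exists (sval c); exists c.
  + by move=> _ [[x Sx] _ <-].
  + move=> _ _ [x Cx <-] [y Cy <-]; have [/asboolP h|/asboolP h] := tot _ _ Cx Cy; [by left|by right].
  exists (exist _ a Sa) => s Cs; apply/asboolP => /=; apply: ha; by exists s.
exists p; split => // l Dl lf.
pose q := (rnorm l + 1)^-1.
have q0 : 0 < q by rewrite invr_gt0; have := rnorm_ge0 l; lra.
pose l' := sc q * l; pose j := star l' * l'; pose u := 1 - p.
have su : star u = u by rewrite starB star1 (pos_sa pp).
have Dl' : D l' by apply: closed_algS.
have l'f : l' * f = 0 by rewrite /l' -mulrA lf mulr0.
have l1 : rnorm l' <= 1.
  rewrite rnorm_scM gtr0_norm // ler_pdivrMl ?mulr1; have := rnorm_ge0 l; lra.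
have Dj : D j by apply: closed_algM => //; apply: Dstar.
have Du : D u by apply: closed_algB => //; apply: closed_alg1.
have pj1 : pos (1 - j).
  rewrite -sc1; apply: le_sc; first exact: pos_sa (pos_starM _).
  by rewrite rnorm_starM; have := rnorm_ge0 l'; nra.
have Sp' : S (p + u * j * u).
  split.
  - by apply: closed_algD => //; apply: closed_algM => //; apply: closed_algM.
  - by apply: posD => //; rewrite -{1}su; apply: pos_conj; apply: pos_starM.
  - have -> : 1 - (p + u * j * u) = u * (1 - j) * u + (1 - p) * p by rewrite /u; ncring.
    apply: posD; first by rewrite -{1}su; apply: pos_conj.
    by apply: posM => //; rewrite mulrBl mulrBr mul1r mulr1.
  - have uf : u * f = f by rewrite mulrBl mul1r pf0 subr0.
    have jf : j * f = 0 by rewrite /j -mulrA l'f mulr0.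
    by rewrite mulrDl pf0 add0r -(mulrA (u * j)) uf -(mulrA u j) jf mulr0.
have := hmax (exist _ _ Sp'); rewrite /le /= => h.
have /(congr1 sval) /= e : exist _ _ Sp' = exist _ p (And4 Dp pp pp1 pf0) :> T.
  apply: h; apply/asboolP; rewrite addrAC subrr add0r -{1}su.
  by apply: pos_conj; apply: pos_starM.
have : u * j * u = 0 by apply: (addrI p); rewrite e addr0.
have -> : u * j * u = star (l' * u) * (l' * u) by rewrite starM su /j !mulrA.
move/starM_eq0; rewrite /l' -mulrA => h3.
have : l * u = 0.
  rewrite -[l * u]mul1r -sc1 -(mulVf (_ : q != 0)) ?gt_eqF // scM -mulrA h3 mulr0 //.
by rewrite /u mulrBr mulr1 => /eqP; rewrite subr_eq0 => /eqP.
Qed.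
End Contraction.

(** The annihilator of f in D is a two-sided ideal since f commutes with D; its
    right unit p is therefore central in D. *)
Lemma annihilator_projection f : pos f -> (forall d, D d -> f * d = d * f) ->
  exists p, [/\ D p, star p = p, p * p = p, p * f = 0 &
  (forall d, D d -> d * p = p * d) /\ forall l, D l -> l * f = 0 -> l * p = l].
Proof.
move=> pf cf; pose q := (rnorm f + 1)^-1.
have f0 := rnorm_ge0 f.
have q0 : 0 < q by rewrite invr_gt0; lra.
have pf' : pos (sc q * f) by apply: posS => //; apply: ltW.
have pf1 : pos (1 - sc q * f).
  rewrite -sc1; apply: le_sc; first exact: pos_sa.
  rewrite rnorm_scM gtr0_norm // ler_pdivrMl ?mulr1; lra.
have [p [Dp pp pf0 hp']] := contraction_annihilator pf' pf1.
have [_ _ DM Dstar _] := sD.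
have sp := pos_sa pp.
have e l : l * (sc q * f) = 0 <-> l * f = 0.
  rewrite mulrA -scC -mulrA; split=> [h|->]; last by rewrite mulr0.
  by rewrite -[l * f]mul1r -sc1 -(mulVf (_ : q != 0)) ?gt_eqF // scM -mulrA h mulr0.
have hl l : D l -> l * f = 0 -> l * p = l by move=> Dl /e; apply: hp'.
have pf00 : p * f = 0 by apply/e.
exists p; split => //; first exact: hl.
split => // d Dd.
have h1 x : D x -> p * x * p = p * x.
  move=> Dx; apply: hl; first exact: DM.
  by rewrite -mulrA -cf // mulrA pf00 mul0r.
have := congr1 star (h1 _ (Dstar _ Dd)).
by rewrite !starM starK sp mulrA h1.
Qed.
End Annihilator.

(** * The relative commutant *)
Section Ucp.
Context {R : realType} {A I : cstarType R}.
Variable Phi : A -> I.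
Hypothesis ucpPhi : ucp [set: A] [set: I] Phi.

Lemma ucpD x y : Phi (x + y) = Phi x + Phi y.
Proof. by have [[_ _ h] _] := ucpPhi; have := h 1 x y Logic.I Logic.I; rewrite !scale1r. Qed.
Lemma ucp0 : Phi 0 = 0.
Proof. by apply: (addrI (Phi 0)); rewrite -ucpD !addr0. Qed.
Lemma ucpB x y : Phi (x - y) = Phi x - Phi y.
Proof. by apply/eqP; rewrite eq_sym subr_eq -ucpD subrK. Qed.
Lemma ucp_sc t x : Phi (sc t * x) = sc t * Phi x.
Proof.
have [[_ _ h] _] := ucpPhi.
by have := h t%:C x 0 Logic.I Logic.I; rewrite ucp0 !addr0 !scE.
Qed.

Lemma ucp_pos x : pos x -> pos (Phi x).
Proof.
move=> /posP[z ->]; have [_ /(_ 1%N (const_mx (star z * z)))] := ucpPhi.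
case=> // [|Z eZ].
  exists (const_mx z); apply/matrixP => i j; rewrite !mxE big_ord1 mxadjE !mxE //.
have := congr1 (fun Y : 'M[I]_1 => Y 0 0) eZ; rewrite !mxE big_ord1 mxadjE => ->.
exact: pos_starM.
Qed.
End Ucp.

Section Main.
Context {R : realType} {M I : cstarType R} {X : completeNormedModType R[i]}.
Variables (pairing : M -> X -> R[i]^o) (D : set M) (iota : M -> I) (Phi : M -> I).
Hypotheses (hp : is_predual pairing) (sD : cstar_subalgebra D) (cD : sigma_closed pairing D).
Hypotheses (injI : injective_system [set: I]) (embD : unital_star_embedding D iota).
Hypotheses (pPhi : pseudo_expectation D iota Phi)
  (uPhi : forall Psi, pseudo_expectation D iota Psi -> Phi = Psi).
Let Dc := relative_commutant D.

Let algDc : closed_alg Dc. Proof. exact: closed_alg_commutant. Qed.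
Let algD : closed_alg D. Proof. exact: closed_alg_subalgebra. Qed.

(** The element k killed by Phi is annihilated by yp + p, which is faithful on
    D: if d (yp + p) = 0 then d p = 0, so d yp = 0 and d = d p = 0. *)
Lemma separating_projection (y : M) : star y = y -> Dc y -> exists yp ym p,
  [/\ pos yp, pos ym, y = yp - ym, Dc yp & Dc ym] /\
  [/\ D p, star p = p, p * p = p, forall d, D d -> d * p = p * d & p * yp = 0] /\
  Phi (ym * (1 - p)) = 0.
Proof.
move=> sy cy; have [yp [ym [pp pm ey y0 hy]]] := pos_neg_parts sy.
have [cyp cym] := hy _ algDc cy.
have [p [Dp sp p2 pyp [cp hpl]]] := annihilator_projection hp sD cD pp cyp.
exists yp, ym, p; split => //; split => //.
have spp : pos p by rewrite -p2; apply: pos_sq.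
have [s [ss es hs]] := pos_sqrt (posD pp spp).
have Dcp : Dc p by move=> d Dd; rewrite cp.
have cS : Dc s by apply: (hs _ algDc); exact: (closed_algD algDc cyp Dcp).
have cs d : D d -> d * s = s * d by move=> Dd; rewrite cS.
have ypp : yp * p = 0 by rewrite -(pos_sa pp) -sp -starM pyp star0.
have ymp : ym * p = p * ym by apply: cym.
have ymyp : ym * yp = 0 by rewrite -(pos_sa pp) -(pos_sa pm) -starM y0 star0.
have fs d : D d -> d * s = 0 -> d = 0.
  move=> Dd ds; have de : d * yp + d * p = 0 by rewrite -mulrDr -es mulrA ds mul0r.
  have dp : d * p = 0.
    by have := congr1 (fun z => z * p) de; rewrite mulrDl -!mulrA ypp p2 mulr0 add0r mul0r.
  by move: de; rewrite dp addr0 => /(hpl _ Dd) <-.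
set k := ym * (1 - p).
have sk : star k = k by rewrite starM starB star1 sp (pos_sa pm) /k mulrBr mulrBl mulr1 mul1r ymp.
have ke : k * (s * s) = 0.
  by rewrite es /k -mulrA mulrBl mul1r [p * _]mulrDr pyp add0r p2 addrK ymyp.
have ks : k * s = 0.
  rewrite -[k * s]starK (_ : star (k * s) = 0) ?star0 //.
  by apply: starM_eq0; rewrite starK starM sk ss -mulrA (mulrA s) mulrA ke mul0r.
have [Psi pPsi Psik] := pseudo_expectation_killing sD embD injI ss cs fs sk ks.
by rewrite (uPhi pPsi).
Qed.

Lemma pos_projection (p : M) : star p = p -> p * p = p -> pos p /\ pos (1 - p).
Proof.
move=> sp p2; split; first by rewrite -p2; apply: pos_sq.
have <- : (1 - p) * (1 - p) = 1 - p by rewrite mulrBr mulr1 mulrBl mul1r p2 subrr subr0.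
by apply: pos_sq; rewrite starB star1 sp.
Qed.

(** Split h - e into its two parts with projection p, and put q = 1 - p.  As
    0 <= h q <= h, Phi kills h q, and it kills ym q; since
    h q + ym q = yp + e q, applying Phi gives Phi yp + e iota q = 0.  Both
    summands are positive, so q = 0, and yp = p yp = 0: that is, h <= e. *)
Lemma pseudo_expectation_faithful (h : M) : Dc h -> pos h -> Phi h = 0 -> h = 0.
Proof.
move=> ch ph Ph; apply: small_eq0 => e e0.
have [uPhi' _] := pPhi; have [[_ _ iD] iM istar iinj] := embD.
have sy : star (h - sc e) = h - sc e by rewrite starB star_sc (pos_sa ph).
have cy : Dc (h - sc e) by exact: (closed_algB algDc ch (closed_algsc _ algDc)).
have [yp [ym [p [[pp pm ey cyp cym] [[Dp sp p2 cp pyp] Pk]]]]] := separating_projection sy cy.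
have [psp psq] := pos_projection sp p2.
set q := 1 - p in Pk psq.
have hq : h * q = q * h by rewrite /q mulrBr mulrBl mulr1 mul1r ch.
have hp0 : h * p = p * h by rewrite ch.
have phq : pos (h * q) by apply: posM.
have Phq : Phi (h * q) = 0.
  apply: pos_anti; first exact: ucp_pos.
  rewrite -[- _]add0r -Ph -ucpB //; apply: ucp_pos => //.
  have -> : h - h * q = h * p by rewrite /q mulrBr mulr1 opprB addrC subrK.
  exact: posM.
have ypp : yp * p = 0 by rewrite -(pos_sa pp) -sp -starM pyp star0.
have Dq : D q by apply: closed_algB => //; apply: closed_alg1.
have e1 : h * q + ym * q = yp + sc e * q.
  have eh : h = yp - ym + sc e by rewrite -ey subrK.
  have ypq : yp * q = yp by rewrite mulrBr mulr1 ypp subr0.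
  by rewrite eh !mulrDl mulNr ypq addrAC subrK.
have : Phi yp + sc e * Phi q = 0.
  by rewrite -ucp_sc // -ucpD // -e1 ucpD // Phq Pk addr0.
have [_ PD] := pPhi; rewrite (PD _ Dq) addrC => e2.
have q2 : q * q = q by rewrite /q mulrBr mulr1 mulrBl mul1r p2 subrr subr0.
have sq : star q = q by exact: pos_sa psq.
have piq : pos (iota q) by rewrite -q2 -{1}sq iM ?istar //; [exact: pos_starM|rewrite sq].
have e3 : sc e * iota q = 0.
  by apply: pos_add_eq0 e2; [apply: posS => //; apply: ltW|apply: ucp_pos].
have iq0 : iota q = 0.
  by rewrite -[iota q]mul1r -sc1 -(mulVf (_ : e != 0)) ?gt_eqF // scM -mulrA e3 mulr0.
have i0 : iota 0 = 0.
  by have := iD (-1) _ _ Dq Dq; rewrite !scaleN1r !addNr.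
have q0 : q = 0 by apply: iinj => //; [exact: closed_alg0|rewrite iq0 i0].
have yp0 : yp = 0.
  by rewrite -[yp]mul1r (_ : 1 = p) //; apply/eqP; rewrite -subr_eq0 -/q q0.
apply: norm_le => //; first exact: ltW.
by rewrite -opprB ey yp0 sub0r opprK.
Qed.

(** The separating projection p is exact by faithfulness of Phi on D^c: x p and
    x (1 - p) are the two parts of x up to sign, and subtracting r / 2 on the
    positive side and - r / 2 on the negative side halves the norm. *)
Lemma halving (x : M) (r : R) : star x = x -> Dc x -> rnorm x <= r ->
  exists z, [/\ D z, star z = z, Dc z & rnorm (x - z) <= r / 2].
Proof.
move=> sx cx xr; have r0 : 0 <= r by apply: le_trans xr; apply: rnorm_ge0.
have [xp [xm [p [[pp pm ex cxp cxm] [[Dp sp p2 cp pxp] Pk]]]]] := separating_projection sx cx.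
have [psp psq] := pos_projection sp p2.
set q := 1 - p in Pk psq.
have Dq : D q by apply: closed_algB => //; apply: closed_alg1.
have cq : Dc q by move=> d Dd; rewrite /q mulrBl mulrBr mul1r mulr1 cp.
have xmq : xm * q = 0.
  have c : xm * q = q * xm by apply: cxm.
  apply: pseudo_expectation_faithful => //; last exact: posM.
  exact: (closed_algM algDc).
have xpp : xp * p = 0 by rewrite -(pos_sa pp) -sp -starM pxp star0.
have xq : x * q = xp by rewrite ex mulrBl xmq subr0 mulrBr mulr1 xpp subr0.
have xp' : x * p = - xm.
  rewrite ex mulrBl xpp sub0r; congr (- _).
  by apply/eqP; rewrite eq_sym -subr_eq0; move: xmq; rewrite /q mulrBr mulr1 => ->.
have rr : r = r / 2 + r / 2 by field.
exists (sc (r / 2) * (q - p)); split.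
- by apply: closed_algS => //; apply: closed_algB.
- by rewrite starM star_sc scC starB sp (pos_sa psq).
- by apply: (closed_algS _ algDc); apply: (closed_algB algDc) => // d Dd; rewrite cp.
have h2 : 0 <= r / 2 by rewrite divr_ge0.
apply: order_norm => //.
  have -> : sc (r / 2) - (x - sc (r / 2) * (q - p)) = (sc r - x) * q + xm.
    by rewrite mulrBl xq ex {3}rr scD /q; ncring.
  apply: posD => //; apply: posM => //; first exact: le_sc.
  have c : x * q = q * x by apply: cx.
  by rewrite mulrBl [in RHS]mulrBr scC c.
have -> : sc (r / 2) + (x - sc (r / 2) * (q - p)) = (sc r - - x) * p + xp.
  by rewrite opprK mulrDl xp' ex {3}rr scD /q; ncring.
apply: posD => //; apply: posM => //; first by apply: le_sc; rewrite ?starN ?sx ?rnormN.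
have c : x * p = p * x by apply: cx.
by rewrite opprK mulrDl mulrDr scC c.
Qed.

Lemma approximate_from_algebra n : forall x : M, star x = x -> Dc x ->
  exists2 z, D z & rnorm (x - z) <= rnorm x / 2 ^+ n.
Proof.
elim: n => [|n ih] x sx cx.
  by exists 0; [exact: closed_alg0|rewrite subr0 expr0 divr1].
have [z [Dz sz cz hz]] := halving sx cx (lexx _).
have sxz : star (x - z) = x - z by rewrite starB sx sz.
have cxz : Dc (x - z) by exact: (closed_algB algDc cx cz).
have [w Dw hw] := ih _ sxz cxz.
exists (z + w); first exact: closed_algD.
rewrite opprD addrA (le_trans hw) // exprS invfM mulrA ler_wpM2r //.
Qed.

Lemma sa_commutant_sub x : star x = x -> Dc x -> D x.
Proof.
move=> sx cx.
pose u n := sval (cid2 (approximate_from_algebra n sx cx)).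
have hu n : D (u n) /\ rnorm (x - u n) <= rnorm x / 2 ^+ n.
  by rewrite /u; case: cid2.
have [cl _ _ _] := algD; apply: (cl u) => [n|e e0]; first by case: (hu n).
exists (Num.bound (rnorm x / e)) => k Kk; rewrite rdistC.
apply: le_lt_trans (hu k).2 _; rewrite ltr_pdivrMr ?exprn_gt0 // -ltr_pdivrMl // mulrC.
have /lt_trans -> // := archi_boundP (x := rnorm x / e) (divr_ge0 (rnorm_ge0 _) (ltW e0)).
by rewrite -natrX ltr_nat (leq_ltn_trans Kk) // ltn_expl.
Qed.

Lemma commutant_sub x : Dc x -> D x.
Proof.
move=> cx; have [_ DD _ Dstar _] := sD.
have csx : Dc (star x).
  move=> d Dd; have := congr1 star (cx _ (Dstar _ Dd)).
  by rewrite !starM starK => ->.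
have D1 : D (x + star x).
  by apply: sa_commutant_sub; [rewrite starD starK addrC|exact: (closed_algD algDc)].
have D2 : D (iu * (x - star x)).
  apply: sa_commutant_sub.
    by rewrite starM starB starK star_iu mulrN -iuC -mulrN opprB.
  by move=> d Dd; rewrite -mulrA mulrBl cx // csx // -mulrBr !mulrA iuC.
have -> : x = sc (2^-1) * ((- 'i) *: (iu * (x - star x)) + (x + star x)).
  rewrite scaleNr iuE mulrA iu2 mulN1r opprK.
  have -> : x - star x + (x + star x) = x + x by ncring.
  by rewrite mulrDr -mulrDl sc_half_half mul1r.
by apply: closed_algS => //; apply: DD.
Qed.
End Main.

Theorem theorem5p3 (R : realType) (M : cstarType R)
    (predual : completeNormedModType R[i]) (pairing : M -> predual -> R[i]^o)
    (D : set M) (I : cstarType R) (iota : M -> I) :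
  wstar_inclusion pairing D ->
  injective_envelope D iota ->
  unique_pseudo_expectation D iota ->
  relative_commutant D = cstar_center D.
Proof.
move=> [hp sD cD] [injI embD _] [Phi [pPhi uPhi]].
apply/seteqP; split => x; last by case.
move=> cx; split => //.
exact: (commutant_sub hp sD cD injI embD pPhi uPhi).
Qed.
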